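(* The function $\kappa(r)$, $0<r\le1$, is continuous and nonincreasing. It satisfies the bounds $$0\le\kappa(r_1)-\kappa(r_2)\le\frac1{r_1}-\frac1{r_2}\qquad\text{for } r_1<r_2 \ (r_1,r_2\in(0,1]),$$ and, for all $r\in(0,1]$, $$\max\Big\{4,\ \frac32+\frac{r^2+2(1+r)}{2r(1+r)}\Big\}\le\kappa(r)\le3+\frac1r .$$
   Context: Definition of $\kappa(r)$ for $r\in(0,1]$: let $Y_{i,j}$, $(i,j)\in\mathbb N^2$ ($\mathbb N=\{1,2,\dots\}$), be i.i.d. exponential random variables with mean $1$, and let $w_{i,j}=1$ if $i\neq j$, $w_{i,i}=1/r$. Let $T_{n,n}=\max_\pi\sum_{k=1}^{2n-1}w_{i_k,j_k}Y_{i_k,j_k}$, the maximum over paths $\pi=\{(1,1)=(i_1,j_1),\dots,(i_{2n-1},j_{2n-1})=(n,n)\}$ with $(i_k,j_k)-(i_{k-1},j_{k-1})\in\{(1,0),(0,1)\}$ for each $k$. By superadditivity and Kingman's subadditive ergodic theorem the almost sure limit $\kappa(r)=\lim_{n\to\infty}n^{-1}T_{n,n}$ exists and is a constant. *)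

(* Defs.v *)
From mathcomp Require Import all_boot all_order all_algebra.
From mathcomp Require Import all_classical all_reals all_analysis.

Set Implicit Arguments.
Unset Strict Implicit.
Unset Printing Implicit Defensive.

Import Order.TTheory GRing.Theory Num.Theory.
Import numFieldNormedType.Exports.

Local Open Scope classical_set_scope.
Local Open Scope ring_scope.

(* Lattice sites are pairs (i, j) : nat * nat; as the lattice is {1, 2, ...}^2,
   only sites with both coordinates positive carry weights. *)
Definition sites : set (nat * nat) := [set x | (0 < x.1)%N /\ (0 < x.2)%N].

Definition lattice_step : rel (nat * nat) :=
  fun x y => (y == (x.1.+1, x.2)) || (y == (x.1, x.2.+1)).

(* The default value (0, 0) of head and last is not a site, so the endpoint
   conditions force a path to be nonempty and there is no path for n = 0. *)
Definition lattice_path (n : nat) : set (seq (nat * nat)) :=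
  [set p | [/\ size p = (2 * n - 1)%N, head (0, 0)%N p = (1, 1)%N,
               last (0, 0)%N p = (n, n) & sorted lattice_step p]].

Definition slow_weight {R : realType} (r : R) (x : nat * nat) : R :=
  if x.1 == x.2 then r^-1 else 1.

Definition path_time {R : realType} (r : R) (y : nat * nat -> R)
    (p : seq (nat * nat)) : R :=
  \sum_(x <- p) slow_weight r x * y x.

(* For n >= 1 the set is finite and nonempty, so its sup is its maximum. *)
Definition passage_time {R : realType} (r : R) (y : nat * nat -> R)
    (n : nat) : R :=
  sup [set path_time r y p | p in lattice_path n].

Definition mutually_independent {d : measure_display} {T : measurableType d}
    {R : realType} (P : probability T R) {I : choiceType} (D : set I)
    (X : I -> {RV P >-> R}) : Prop :=
  forall (s : seq I) (B : I -> set R),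
    uniq s -> (forall i, i \in s -> D i) -> (forall i, measurable (B i)) ->
    P (\bigcap_(i in [set` s]) (X i @^-1` B i)) =
    (\prod_(i <- s) P (X i @^-1` B i))%E.

(* The parameter of exponential_prob is the rate, so rate 1 means mean 1. *)
Definition iid_exponential_mean1 {d : measure_display} {T : measurableType d}
    {R : realType} (P : probability T R) {I : choiceType} (D : set I)
    (X : I -> {RV P >-> R}) : Prop :=
  mutually_independent D X /\
  forall i, D i -> forall B : set R, measurable B ->
    distribution P (X i) B = exponential_prob (1 : R) B.

Definition is_as_time_constant {d : measure_display} {T : measurableType d}
    {R : realType} (P : probability T R) (Y : nat * nat -> {RV P >-> R})
    (r c : R) : Prop :=
  {ae P, forall w : T,
    (fun n : nat => n%:R^-1 * passage_time r (fun x => Y x w) n) @ \oo --> c}.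

(* Main.v *)
Require Import Defs.
From HB Require Import structures.
From mathcomp Require Import all_boot all_order all_algebra.
From mathcomp Require Import all_classical all_reals all_analysis.
From mathcomp Require Import measurable_realfun ring lra zify.

Set Implicit Arguments.
Unset Strict Implicit.
Unset Printing Implicit Defensive.

Import Order.TTheory GRing.Theory Num.Theory.
Import numFieldNormedType.Exports.

Local Open Scope classical_set_scope.
Local Open Scope ring_scope.

(** The maximum over lattice paths obeys the recursion
    L(i,j) = y(i,j) + max (L(i-1,j)) (L(i,j-1)), and everything about paths that
    is used below is an induction on this recursion: monotonicity, subadditivity
    and homogeneity in the weights.  As n^-1 T_n converges almost surely to
    kappa r, an inequality for kappa r follows from one sample point at which
    n^-1 T_n converges and which satisfies a matching inequality for infinitely
    many n.  Fatou's lemma provides such points from bounds on expectations or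
    second moments ([frequently_below_mean], [frequently_above_mean]).

    Lowering r2 to r1 raises the weight of the k-th diagonal site by
    (1/r1 - 1/r2) Y(k,k) and leaves the others alone, so T_n increases, by at most
    (1/r1 - 1/r2) times the sum of n diagonal variables of mean 1.  This gives
    monotonicity, the Lipschitz bound in 1/r and hence continuity.  It also
    reduces the bounds 4 <= kappa r <= 3 + 1/r to Rost's theorem kappa 1 = 4.

    For Rost's theorem, multiply the weights of the first row and the first
    column by a and b, where 1/a + 1/b = 1, and call the new passage time G(a,b).
    By Burke's property ([iid_exp_burke], built on the three-variable
    computation [burke_set_law]) the increments of G(a,b) along the top row of
    the square are independent exponentials of mean a, so G(a,b) is a sum of two sums of independent variables
    and G(a,b)/n is close to a + b in mean square ([deviation_sqr]).  As
    T_n <= G(2,2), kappa 1 <= 4.  For the reverse inequality, G is convex in (a,b)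
    and equals T_n at (1,1), so that
    (1 + h) G(2,2) <= h T_n + G(2+h,2+h).
    A path leaves the corner along the row or along the column, so that
    G(2+h,2+h) <= max (G(2+h,b)) (G(b,2+h)) with 1/(2+h) + 1/b = 1, and
    2 + h + b = 4 + O(h^2).  Dividing by n h gives kappa 1 >= 4 - O(h).

    The last lower bound comes from a greedy path.  On every antidiagonal pair
    (k,k+1), (k+1,k) it takes the larger weight, which gains 3/2 on average.
    Between two consecutive pairs it crosses the diagonal site, gaining Y(k,k)/r,
    unless both chosen sites lie on the same side, when it may use the other
    corner instead and gain the excess of that corner over Y(k,k)/r.  The sides
    are fair coin flips, so the excess contributes 2 (1/4) r/(1+r). *)

(** * Last-passage recursion and the passage time *)

Section LastPassage.
Context {R : realType}.
Implicit Types (y : nat * nat -> R) (i j n : nat).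

(** The passage time from (1,1) to (i,j).  The value 0 outside the quadrant plays
    the role of minus infinity, which is harmless for nonnegative weights. *)
Fixpoint lpp y i : nat -> R :=
  if i is i'.+1 then
    fix row j := if j is j'.+1 then
      y (i'.+1, j'.+1) + Num.max (lpp y i' j'.+1) (row j') else 0
  else fun=> 0.

Lemma lppSS y i j :
  lpp y i.+1 j.+1 = y (i.+1, j.+1) + Num.max (lpp y i j.+1) (lpp y i.+1 j).
Proof. by []. Qed.

#[local] Arguments lpp : simpl never.

Lemma lpp0 y i : lpp y i 0%N = 0.
Proof. by case: i. Qed.

Lemma lpp11 y : lpp y 1%N 1%N = y (1, 1)%N.
Proof. by rewrite lppSS lpp0 maxxx addr0. Qed.

Lemma lpp_ind (Q : nat -> nat -> Prop) :
  (forall j, Q 0%N j) -> (forall i, Q i 0%N) ->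
  (forall i j, Q i j.+1 -> Q i.+1 j -> Q i.+1 j.+1) -> forall i j, Q i j.
Proof.
move=> Q0 Q1 QS; elim=> [//|i IHi]; elim=> [//|j IHj].
exact: QS.
Qed.

(** The recursion never reads a weight on the axes. *)
Lemma eq_lpp y y' : (forall x, sites x -> y x = y' x) -> lpp y =2 lpp y'.
Proof.
move=> yy'; apply: lpp_ind => [//|i|i j]; first by rewrite !lpp0.
by rewrite !lppSS => -> ->; rewrite yy'.
Qed.

Lemma ler_lpp y y' i j :
  (forall x, sites x -> y x <= y' x) -> lpp y i j <= lpp y' i j.
Proof.
move=> yy'; move: i j; apply: lpp_ind => [//|i|i j ij ji]; first by rewrite !lpp0.
rewrite !lppSS lerD ?yy'//.
by rewrite ge_max !le_max ij ji orbT.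
Qed.

Lemma lpp_ge0 y i j : (forall x, sites x -> 0 <= y x) -> 0 <= lpp y i j.
Proof.
move=> y0; move: i j; apply: lpp_ind => [//|i|i j ij ji]; first by rewrite !lpp0.
by rewrite lppSS addr_ge0 ?y0// le_max ij.
Qed.

(** A path that is optimal for the sum of two weights is admissible for each. *)
Lemma lppD_le y y' i j :
  lpp (fun x => y x + y' x) i j <= lpp y i j + lpp y' i j.
Proof.
move: i j; apply: lpp_ind => [j|i|i j ij ji]; rewrite ?lpp0 ?addr0//.
rewrite !lppSS addrACA lerD2l ge_max; apply/andP; split.
  by rewrite (le_trans ij)// lerD// le_max lexx.
by rewrite (le_trans ji)// lerD// le_max lexx orbT.
Qed.

Lemma lppZ y (c : R) i j : 0 <= c ->
  lpp (fun x => c * y x) i j = c * lpp y i j.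
Proof.
move=> c0; move: i j; apply: lpp_ind => [j|i|i j]; rewrite ?lpp0 ?mulr0//.
by rewrite !lppSS => -> ->; rewrite mulrDr maxr_pMr.
Qed.

Lemma lpp_column1 y n : (forall x, sites x -> 0 <= y x) ->
  lpp y 1%N n = \sum_(0 <= k < n) y (1%N, k.+1).
Proof.
move=> y0; elim: n => [|n IH]; first by rewrite big_nil.
rewrite big_nat_recr//= lppSS addrC -IH; congr (_ + _).
by apply/max_idPr/lpp_ge0.
Qed.

Lemma lpp_row1 y n : (forall x, sites x -> 0 <= y x) ->
  lpp y n 1%N = \sum_(0 <= k < n) y (k.+1, 1%N).
Proof.
move=> y0; elim: n => [|n IH]; first by rewrite big_nil.
rewrite big_nat_recr//= lppSS addrC -IH; congr (_ + _).
by apply/max_idPl; rewrite lpp0; apply/lpp_ge0.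
Qed.

(** Each diagonal site is visited at most once. *)
Lemma lpp_diag_le (d : nat -> R) i j : (forall k, 0 <= d k) ->
  lpp (fun x => if x.1 == x.2 then d x.1 else 0) i j <=
  \sum_(0 <= k < minn i j) d k.+1.
Proof.
move=> d0; move: i j; apply: lpp_ind => [j|i|i j ij ji].
- by rewrite min0n big_nil.
- by rewrite minn0 big_nil lpp0.
rewrite lppSS /= eqSS; have [eij|neij] := eqVneq i j.
  rewrite eij minnn big_nat_recr//= [leLHS]addrC lerD2r ge_max.
  rewrite eij (minn_idPl _)// in ij; rewrite eij (minn_idPr _)// in ji.
  by rewrite ij ji.
have mono a b : (a <= b)%N -> \sum_(0 <= k < a) d k.+1 <= \sum_(0 <= k < b) d k.+1.
  move=> ab; rewrite (big_cat_nat (leq0n a) ab)/= lerDl.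
  exact: sumr_ge0.
by rewrite add0r ge_max (le_trans ij) ?(le_trans ji)//; apply: mono; lia.
Qed.

(** The upper half of the identification of [passage_time] with [lpp]; the fact
    that a path stays among the sites is proved along the way because the weights
    are nonnegative only there. *)
Lemma path_sum_le_lpp y p :
  (forall x, sites x -> 0 <= y x) ->
  head (0, 0)%N p = (1, 1)%N -> sorted lattice_step p ->
  sites (last (0, 0)%N p) /\
  \sum_(x <- p) y x <= lpp y (last (0, 0)%N p).1 (last (0, 0)%N p).2.
Proof.
move=> y0; elim/last_ind: p => [//|p x IH].
case: p IH => [_ /= -> _|a p IH hd].
  by rewrite big_seq1 lpp11.
rewrite last_rcons -cats1 -[sorted _ _]/(path _ _ _) cat_path => /andP[pth].
rewrite /= andbT => step.
have {IH} [] := IH hd pth.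
have -> : last (0, 0)%N (a :: p) = last a p by [].
move: (last a p) step => -[i j] /orP[]/eqP-> [/= i0 j0] le.
- split; first by [].
  rewrite -cat_cons big_cat/= big_seq1 addrC; case: j j0 le => [//|j] _ le.
  by rewrite lppSS lerD2l le_max le.
- split; first by [].
  rewrite -cat_cons big_cat/= big_seq1 addrC; case: i i0 le => [//|i] _ le.
  by rewrite lppSS lerD2l le_max le orbT.
Qed.

(** The lower half: an optimal path is obtained by following the larger
    predecessor, and along the first row or column the only one. *)
Lemma lpp_path y i j : (forall x, sites x -> 0 <= y x) ->
  exists p, [/\ size p = (i + j).+1, head (0, 0)%N p = (1, 1)%N,
    last (0, 0)%N p = (i.+1, j.+1), sorted lattice_step p &
    \sum_(x <- p) y x = lpp y i.+1 j.+1].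
Proof.
move=> y0; pose Q i j := exists p, [/\ size p = (i + j).+1,
    head (0, 0)%N p = (1, 1)%N, last (0, 0)%N p = (i.+1, j.+1),
    sorted lattice_step p & \sum_(x <- p) y x = lpp y i.+1 j.+1].
have extend i1 j1 i2 j2 : (i2 + j2 = (i1 + j1).+1)%N ->
    lattice_step (i1.+1, j1.+1) (i2.+1, j2.+1) ->
    lpp y i2.+1 j2.+1 = y (i2.+1, j2.+1) + lpp y i1.+1 j1.+1 ->
    Q i1 j1 -> Q i2 j2.
  move=> e st le [p [sp hp lp srt sm]]; exists (rcons p (i2.+1, j2.+1)).
  split; rewrite ?size_rcons ?sp ?e ?last_rcons//.
  - by case: p sp hp {lp srt sm}.
  - case: p sp hp lp srt sm => [//|a p] _ _ /= lp pth _.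
    by rewrite rcons_path pth lp.
  - by rewrite -cats1 big_cat/= big_seq1 sm le addrC.
rewrite -/(Q i j); move: i j; elim=> [|i IHi]; elim=> [|j IHj].
- exists [:: (1, 1)%N]; split => //.
  by rewrite big_seq1 lpp11.
- apply: (extend _ _ _ _ _ _ _ IHj) => //; first by apply/orP; right.
  by rewrite lppSS; congr (_ + _); apply/max_idPr/lpp_ge0.
- apply: (extend _ _ _ _ _ _ _ (IHi 0%N)) => //.
    by apply/orP; left.
  rewrite lppSS; congr (_ + _); apply/max_idPl.
  by rewrite lpp0; apply: lpp_ge0.
- have [le|le] := leP (lpp y i.+1 j.+2) (lpp y i.+2 j.+1).
    apply: (extend _ _ _ _ _ _ _ IHj) => //; first by rewrite /=; lia.
      by apply/orP; right.
    by rewrite lppSS (max_idPr le).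
  apply: (extend _ _ _ _ _ _ _ (IHi j.+1)) => //.
    by apply/orP; left.
  by rewrite lppSS (max_idPl (ltW le)).
Qed.

Definition slowed (r : R) y : nat * nat -> R := fun x => slow_weight r x * y x.

Lemma slow_weight_ge0 (r : R) x : 0 < r -> 0 <= slow_weight r x.
Proof. by move=> r0; rewrite /slow_weight; case: ifP; rewrite ?invr_ge0 ?ltW. Qed.

Lemma passage_timeE (r : R) y n : 0 < r -> (forall x, sites x -> 0 <= y x) ->
  passage_time r y n.+1 = lpp (slowed r y) n.+1 n.+1.
Proof.
move=> r0 y0.
have w0 x : sites x -> 0 <= slowed r y x.
  by move=> /y0 yx; rewrite mulr_ge0// slow_weight_ge0.
have [p [sp hp lp srt sm]] := lpp_path n n w0.
have inA : [set path_time r y p | p in lattice_path n.+1] (lpp (slowed r y) n.+1 n.+1).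
  by exists p => //; split => //; rewrite sp; lia.
have ubA : ubound [set path_time r y p | p in lattice_path n.+1]
    (lpp (slowed r y) n.+1 n.+1).
  move=> _ [q [sq hq lq srtq] <-].
  by have [_] := path_sum_le_lpp w0 hq srtq; rewrite lq.
apply/eqP; rewrite eq_le; apply/andP; split.
  by apply: ge_sup => //; exists (lpp (slowed r y) n.+1 n.+1).
by apply: ub_le_sup => //; exists (lpp (slowed r y) n.+1 n.+1).
Qed.

Lemma ler_lpp_slowed (r1 r2 : R) y n : 0 < r1 -> r1 <= r2 ->
  (forall x, sites x -> 0 <= y x) ->
  lpp (slowed r2 y) n n <= lpp (slowed r1 y) n n.
Proof.
move=> r10 r12 y0; apply: ler_lpp => x /y0 yx; rewrite ler_wpM2r//.
by rewrite /slow_weight; case: ifP => // _; rewrite lef_pV2 ?posrE// (lt_le_trans r10).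
Qed.

(** The two weights differ by a weight carried by the diagonal, so subadditivity
    and [lpp_diag_le] apply. *)
Lemma lpp_slowed_lipschitz (r1 r2 : R) y n : 0 < r1 -> r1 <= r2 ->
  (forall x, 0 <= y x) ->
  lpp (slowed r1 y) n n <=
  lpp (slowed r2 y) n n + (r1^-1 - r2^-1) * \sum_(0 <= k < n) y (k.+1, k.+1).
Proof.
move=> r10 r12 y0; have r20 := lt_le_trans r10 r12.
have c0 : 0 <= r1^-1 - r2^-1 by rewrite subr_ge0 lef_pV2 ?posrE.
pose d k := (r1^-1 - r2^-1) * y (k, k).
have -> : lpp (slowed r1 y) n n =
    lpp (fun x => slowed r2 y x + (if x.1 == x.2 then d x.1 else 0)) n n.
  apply: eq_lpp => -[i j] _; rewrite /slowed /slow_weight /d /=.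
  by case: eqP => [->|_]; rewrite ?addr0// -mulrDl addrC subrK.
apply: le_trans (lppD_le _ _ _ _) _; rewrite lerD2l.
apply: le_trans (lpp_diag_le _ _ _) _; first by move=> k; apply: mulr_ge0.
by rewrite minnn -mulr_sumr.
Qed.

End LastPassage.

(** * Boundary weights, increments along rows, and the greedy path *)

Section Boundary.
Context {R : realType}.
Implicit Types (y S : nat * nat -> R) (i j n : nat) (a b : R).
#[local] Arguments lpp : simpl never.

(** The corner (1,1) keeps its weight, so that the multipliers a = b = 1 give back
    the original weights. *)
Definition boundary a b y : nat * nat -> R := fun x =>
  if x.2 == 1%N then (if x.1 == 1%N then y x else a * y x)
  else if x.1 == 1%N then b * y x else y x.

Lemma boundary_ge0 a b y x : 0 <= a -> 0 <= b -> 0 <= y x -> 0 <= boundary a b y x.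
Proof.
by move=> a0 b0 y0; rewrite /boundary; do 2?case: ifP => _ //; rewrite mulr_ge0.
Qed.

Lemma lpp_boundary_mono a b y i j : 1 <= a -> 1 <= b ->
  (forall x, 0 <= y x) -> lpp y i j <= lpp (boundary a b y) i j.
Proof.
move=> a1 b1 y0; apply: ler_lpp => x _; rewrite /boundary.
by do 2?case: ifP => _ //; rewrite ler_peMl.
Qed.

(** After the corner a path runs along the first column or along the first row,
    and meets only one of the two multipliers. *)
Lemma lpp_boundary_corner a b y i j : 0 <= b -> b <= a ->
  (forall x, 0 <= y x) ->
  lpp (boundary a a y) i j <=
  Num.max (lpp (boundary a b y) i j) (lpp (boundary b a y) i j).
Proof.
move=> b0 ba y0; have a0 := le_trans b0 ba.
move: i j; apply: lpp_ind => [j|i|i j ij ji]; rewrite ?lpp0 ?maxxx//.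
have bd0 c d x : 0 <= c -> 0 <= d -> sites x -> 0 <= boundary c d y x.
  by move=> c0 d0 _; exact: boundary_ge0.
case: j ij ji => [|j] ij ji.
  rewrite !lpp_row1; try by move=> x; exact: bd0.
  by rewrite le_max; apply/orP; left; apply: ler_sum => k _; rewrite /boundary.
case: i ij ji => [|i] ij ji.
  rewrite !lpp_column1; try by move=> x; exact: bd0.
  by rewrite le_max; apply/orP; right; apply: ler_sum => -[|k].
rewrite !lppSS /boundary/= -addr_maxr lerD2l ge_max.
apply/andP; split.
  by apply: le_trans ij _; rewrite ge_max !le_max !lexx !orbT.
by apply: le_trans ji _; rewrite ge_max !le_max !lexx !orbT.
Qed.

(** Convexity of the passage time in the pair of multipliers, along the line
    through (1,1) and (a,b). *)
Lemma lpp_boundary_convex a b h y i j : 0 <= h ->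
  (1 + h) * lpp (boundary a b y) i j <=
  h * lpp y i j + lpp (boundary (a + h * (a - 1)) (b + h * (b - 1)) y) i j.
Proof.
move=> h0; have h10 : 0 <= 1 + h by rewrite addr_ge0.
rewrite -!lppZ//; apply: le_trans (lppD_le _ _ _ _); apply: ler_lpp => x _.
rewrite /boundary; do 2?case: ifP => _; rewrite le_eqVlt; apply/orP; left; apply/eqP; ring.
Qed.

(** The state of a sweep over the bulk sites.  The entries (i,1) and (1,j) hold the
    current horizontal increment in column i and vertical increment in row j;
    processing the site c = (i,j) replaces both by the increments on the far side
    of c, using the weight stored at c. *)
Definition burke_step S (c : nat * nat) : nat * nat -> R := fun x =>
  if x == (c.1, 1%N) then S c + Num.max 0 (S (c.1, 1%N) - S (1%N, c.2))
  else if x == (1%N, c.2) then S c + Num.max 0 (S (1%N, c.2) - S (c.1, 1%N))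
  else S x.

Definition bulk_row n j : seq (nat * nat) := [seq (i, j) | i <- iota 2 n].

(** The order matters: a site is processed after its left and lower neighbours. *)
Definition bulk n : seq (nat * nat) := flatten [seq bulk_row n j | j <- iota 2 n].

(** The form in which the recursion for [lpp] produces increments. *)
Lemma max0_subr (p q : R) : Num.max 0 (p - q) = Num.max p q - q.
Proof. by rewrite addr_maxl subrr maxC. Qed.

Let iota2S m : iota 2 m.+1 = iota 2 m ++ [:: m.+2].
Proof. by rewrite -[m.+1]addn1 iotaD add2n addn1. Qed.

Section Increments.
Variables (y : nat * nat -> R) (n : nat).
Hypothesis y0 : forall x, 0 <= y x.
Let L := lpp y.

(** The invariant of the sweep after the first m columns of row j.+1 have been
    processed: columns up to m already carry increments of row j.+1, later ones
    still those of row j. *)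
Let state j m S :=
  [/\ forall i, (0 < i <= n)%N -> S (i.+1, 1%N) =
        if (i < m)%N then L i.+1 j.+1 - L i j.+1 else L i.+1 j - L i j,
      S (1%N, j.+1) = L m j.+1 - L m j,
      forall k, (j.+1 < k)%N -> S (1%N, k) = y (1%N, k) &
      forall i k, (1 < i)%N -> (1 < k)%N -> S (i, k) = y (i, k)].

Let state_step j m S : (0 < j)%N -> (0 < m <= n)%N -> state j m S ->
  state j m.+1 (burke_step S (m.+1, j.+1)).
Proof.
move=> j0 /andP[m0 mn] [SI SJ SK Sy].
have Ic : S (m.+1, 1%N) = L m.+1 j - L m j by rewrite SI ?m0// ltnn.
have Yc : S (m.+1, j.+1) = y (m.+1, j.+1) by exact: Sy.
have LE : L m.+1 j.+1 = y (m.+1, j.+1) + Num.max (L m j.+1) (L m.+1 j).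
  exact: lppSS.
split.
- move=> i /andP[i0 iN]; rewrite /burke_step/= !xpair_eqE/= eqxx andbT eqSS.
  case: (ltngtP i m) => im.
  + have -> : (i < m.+1)%N by lia.
    rewrite [X in if X then _ else _](_ : _ = false); last by apply/negbTE; lia.
    by rewrite SI ?i0// im.
  + have -> : (i < m.+1)%N = false by lia.
    rewrite [X in if X then _ else _](_ : _ = false); last by apply/negbTE; lia.
    by rewrite SI ?i0//; have -> : (i < m)%N = false by lia.
  + rewrite im ltnS leqnn Yc Ic SJ LE.
    rewrite [X in Num.max 0 X](_ : _ = L m.+1 j - L m j.+1); last by ring.
    by rewrite max0_subr maxC addrA.
- rewrite /burke_step/= !xpair_eqE/= eqxx.
  have -> : (1 == m.+1)%N = false by lia.
  rewrite /= Yc Ic SJ LE.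
  rewrite [X in Num.max 0 X](_ : _ = L m j.+1 - L m.+1 j); last by ring.
  by rewrite max0_subr addrA.
- move=> k jk; rewrite /burke_step/= !xpair_eqE/=.
  have -> : (1 == m.+1)%N = false by lia.
  have -> : (k == j.+1)%N = false by lia.
  by rewrite /= SK.
- move=> i k i1 k1; rewrite /burke_step/= !xpair_eqE/=.
  have -> : (k == 1)%N = false by lia.
  have -> : (i == 1)%N = false by lia.
  by rewrite andbF /= Sy.
Qed.

Let state_row j m S : (0 < j)%N -> (m <= n)%N -> state j 1 S ->
  state j m.+1 (foldl burke_step S (bulk_row m j.+1)).
Proof.
move=> j0; elim: m => [//|m IH] mn st.
rewrite /bulk_row iota2S map_cat foldl_cat/=.
by apply: state_step => //; apply: IH => //; exact: ltnW.
Qed.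

Let state_next j S : state j n.+1 S -> state j.+1 1 S.
Proof.
move=> [SI SJ SK Sy]; split => //.
- by move=> i /andP[i0 iN]; rewrite SI ?i0// ltnS iN; case: i i0 {iN}.
- rewrite SK// /L !lpp_column1//.
  rewrite (big_nat_recr j.+1)//=; ring.
- by move=> k jk; apply: SK; lia.
Qed.

Lemma burke_increments k : (k < n)%N ->
  foldl burke_step y (bulk n) (k.+2, 1%N) = lpp y k.+2 n.+1 - lpp y k.+1 n.+1.
Proof.
move=> kn; suff /(_ n) : forall m, (m <= n)%N ->
    state m.+1 1 (foldl burke_step y (flatten [seq bulk_row n j | j <- iota 2 m])).
  by move=> /(_ (leqnn n))[-> //]; rewrite ?ltnS.
elim=> [_|m IH mn].
  split => //.
  - move=> i /andP[i0 iN]; case: i i0 iN => [//|i] _ iN /=.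
    by rewrite /L !lpp_row1// big_nat_recr//=; ring.
  - by rewrite /L /= lpp11 !lpp_column1// !big_nat_recr//= big_nil; ring.
rewrite iota2S map_cat flatten_cat/= cats0 foldl_cat.
by apply: state_next; apply: state_row => //; apply: IH; exact: ltnW.
Qed.

(** Up the first column, then across the top row of the square. *)
Lemma lpp_burke : lpp y n.+1 n.+1 = \sum_(0 <= k < n.+1) y (1%N, k.+1) +
  \sum_(0 <= k < n) foldl burke_step y (bulk n) (k.+2, 1%N).
Proof.
rewrite [X in _ + X](eq_big_nat _ _ (F2 := fun k => lpp y k.+2 n.+1 - lpp y k.+1 n.+1)).
  by rewrite (telescope_sumr (fun k => lpp y k.+1 n.+1))// lpp_column1//; ring.
by move=> k /andP[_ kn]; rewrite burke_increments.
Qed.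

End Increments.

Definition upward y k : bool := y (k.+1, k) < y (k, k.+1).

(** What the greedy path collects between the pair (k.+1,k.+2), (k.+2,k.+1) and the
    next pair: the larger weight of the next pair, the slowed diagonal site between
    them, and the excess of the outer corner when both chosen sites lie on its
    side. *)
Definition greedy_gain (r : R) y k : R :=
  Num.max (y (k.+2, k.+3)) (y (k.+3, k.+2)) + r^-1 * y (k.+2, k.+2) +
  ((if upward y k.+1 && upward y k.+2
    then Num.max 0 (y (k.+1, k.+3) - r^-1 * y (k.+2, k.+2)) else 0) +
   (if ~~ upward y k.+1 && ~~ upward y k.+2
    then Num.max 0 (y (k.+3, k.+1) - r^-1 * y (k.+2, k.+2)) else 0)).

(** The greedy path is followed through its antidiagonal sites; the induction
    carries the passage time to the site of the last pair that it has chosen. *)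
Lemma greedy_le_lpp (r : R) y n : 0 < r -> (forall x, 0 <= y x) ->
  \sum_(0 <= k < n) greedy_gain r y k <= lpp (slowed r y) n.+2 n.+2.
Proof.
move=> r0 y0.
have w0 x : sites x -> 0 <= slowed r y x by rewrite mulr_ge0// slow_weight_ge0.
pose L := lpp (slowed r y).
have LE i j : L i.+1 j.+1 = slowed r y (i.+1, j.+1) + Num.max (L i j.+1) (L i.+1 j).
  exact: lppSS.
have diag k : slowed r y (k, k) = r^-1 * y (k, k).
  by rewrite /slowed /slow_weight/= eqxx.
have off i j : (i != j) -> slowed r y (i, j) = y (i, j).
  by move=> ij; rewrite /slowed /slow_weight/= (negbTE ij) mul1r.
have key : \sum_(0 <= k < n) greedy_gain r y k <=
    if upward y n.+1 then L n.+1 n.+2 else L n.+2 n.+1.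
  elim: n => [|n IH]; first by rewrite big_nil; case: ifP => _; exact: lpp_ge0.
  rewrite big_nat_recr//= /greedy_gain.
  set s := \sum_(0 <= k < n) _ in IH *.
  have Ld : (if upward y n.+1 then L n.+1 n.+2 else L n.+2 n.+1) +
      r^-1 * y (n.+2, n.+2) <= L n.+2 n.+2.
    by rewrite [leRHS]LE diag addrC lerD2l; case: ifP => _; rewrite le_max lexx ?orbT.
  have LU : L n.+2 n.+3 = y (n.+2, n.+3) + Num.max (L n.+1 n.+3) (L n.+2 n.+2).
    by rewrite LE off//; lia.
  have LD : L n.+3 n.+2 = y (n.+3, n.+2) + Num.max (L n.+2 n.+2) (L n.+3 n.+1).
    by rewrite LE off//; lia.
  have LUU : y (n.+1, n.+3) + L n.+1 n.+2 <= L n.+1 n.+3.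
    by rewrite [leRHS]LE off ?lerD2l ?le_max ?lexx ?orbT//; lia.
  have LDD : y (n.+3, n.+1) + L n.+2 n.+1 <= L n.+3 n.+1.
    by rewrite [leRHS]LE off ?lerD2l ?le_max ?lexx ?orbT//; lia.
  rewrite /upward in IH Ld *; move: IH Ld LU LD LUU LDD.
  rewrite !maxEle.
  by repeat case: ifP => /=; lra.
by apply: le_trans key _; rewrite -/L [leRHS]LE -[leLHS]add0r lerD ?w0//; case: ifP => _;
  rewrite le_max lexx ?orbT.
Qed.

End Boundary.

(** * Integrals against the exponential distribution *)

Section Exponential.
Context {R : realType}.
Local Notation mu := (@lebesgue_measure R).
Implicit Types (c k t u v x y z : R).

(** Kept opaque, so that unfolding does not lose the probability structure, which
    [exponential_prob] has only relative to a proof that its rate is positive. *)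
Fact exp1_subproof : {p : probability (measurableTypeR R) R |
  forall A, p A = exponential_prob (1 : R) A}.
Proof.
by exists (exponential_distribution_exponential_prob__canonical__probability_measure_Probability
  (@ltr01 R)).
Qed.

Definition exp1 : probability (measurableTypeR R) R := sval exp1_subproof.

Lemma exp1E A : exp1 A = exponential_prob (1 : R) A.
Proof. exact: (svalP exp1_subproof). Qed.

Lemma integral_expR_tail k t : 0 < k ->
  (\int[mu]_(x in `[t, +oo[) (k * expR (- k * x))%:E = (expR (- k * t))%:E)%E.
Proof.
move=> k0.
have dF x : is_derive x 1 (fun x => - expR (- k * x)) (k * expR (- k * x)).
  apply: is_derive_eq; rewrite /GRing.scale/=; ring.
rewrite (@ge0_continuous_FTC2y _ _ (fun x => - expR (- k * x)) _ 0).
- by rewrite sub0e -EFinN opprK.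
- by move=> x _; rewrite mulr_ge0 ?expR_ge0// ltW.
- apply: continuous_subspaceT => x.
  apply: cvgM; first exact: cvg_cst.
  apply: continuous_comp; last exact: continuous_expR.
  by apply: cvgM; [exact: cvg_cst|exact: cvg_id].
- rewrite -oppr0; apply: cvgN.
  rewrite (_ : (fun x => expR (- k * x)) = (fun x => expR (- (k * x)))).
    by apply: (cvg_comp (fun x => k * x) (fun x => expR (- x)));
      [exact: gt0_cvgMry|exact: cvgr_expR].
  by apply/funext => x; rewrite mulNr.
- by move=> x _; case: (dF x).
- apply: cvg_at_right_filter.
  have : {for t, continuous (fun x => - expR (- k * x))}.
    by apply: differentiable_continuous; apply/derivable1_diffP; case: (dF t).
  by [].
- by move=> x _; rewrite derive1E; apply: derive_val.
Qed.

Lemma integral_exp1 (f : measurableTypeR R -> \bar R) :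
  measurable_fun setT f -> (forall x, 0 <= f x)%E ->
  (\int[exp1]_x f x = \int[mu]_(x in `[0%R, +oo[) (f x * (expR (- x))%:E))%E.
Proof.
move=> mf f0.
pose p := exponential_pdf (1 : R).
have mp : measurable_fun setT p by exact: measurable_exponential_pdf.
have dom : exp1 `<< mu.
  apply/null_content_dominatesP => /= A mA A0.
  by rewrite exp1E; apply: null_set_integral => //; apply/measurable_funTS/measurable_EFinP.
rewrite -(Radon_Nikodym_SigmaFinite.change_of_variables dom f0 measurableT mf).
have -> : (\int[mu]_x (f x * Radon_Nikodym_SigmaFinite.f exp1 mu x) =
    \int[mu]_x (f x * (p x)%:E))%E.
  apply: ae_eq_integral => //.
  - apply: emeasurable_funM => //; apply: (measurable_int mu).
    exact: Radon_Nikodym_SigmaFinite.f_integrable.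
  - by apply: emeasurable_funM => //; exact/measurable_EFinP.
  - apply: ae_eqe_mul2l; apply: integral_ae_eq => //.
    + exact: Radon_Nikodym_SigmaFinite.f_integrable.
    + exact/measurable_EFinP.
    + by move=> E _ mE; rewrite -Radon_Nikodym_SigmaFinite.f_integral//; exact: exp1E.
rewrite [RHS]integral_mkcond; apply: eq_integral => x _.
rewrite patchE /p /exponential_pdf patchE; case: ifPn => // _; last by rewrite mule0.
by rewrite mul1r mulN1r.
Qed.

Lemma exp1_tail t : 0 <= t -> exp1 `]t, +oo[%classic = (expR (- t))%:E.
Proof.
move=> t0; rewrite -[`]t, +oo[%classic]setIT -integral_indic//.
rewrite integral_exp1//; last exact/measurable_EFinP.
rewrite -[in RHS](mul1r t) -mulNr -integral_expR_tail//.
rewrite -integral_itv_obnd_cbnd; last first.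
  apply/measurable_EFinP/measurable_funM => //.
  by apply/measurable_funTS; apply: measurableT_comp => //.
rewrite [LHS]integral_mkcond [RHS]integral_mkcond; apply: eq_integral => x _.
rewrite !patchE indicE !mem_setE !in_itv/= !andbT mul1r.
have [tx|xt] := ltP t x.
  by rewrite (le_trans t0 (ltW tx)) -EFinM mul1r mulN1r.
by rewrite mul0e if_same.
Qed.

Lemma exp1_le0 : exp1 `]-oo, 0]%classic = 0%E.
Proof.
have := probability_setC exp1 (measurable_itv `]0, +oo[).
by rewrite setCitvr => ->; rewrite exp1_tail// oppr0 expR0 subee.
Qed.

Lemma integral_exp1_expR c : -1 < c ->
  (\int[exp1]_x (expR (- c * x))%:E = (1 + c)^-1%:E)%E.
Proof.
move=> c1; have k0 : 0 < 1 + c by rewrite -ltrBlDl sub0r.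
rewrite integral_exp1; last 2 first.
- by apply/measurable_EFinP; apply: measurableT_comp => //; exact: measurable_funM.
- by move=> x; rewrite lee_fin expR_ge0.
transitivity (\int[mu]_(x in `[0%R, +oo[)
    ((1 + c)^-1%:E * ((1 + c) * expR (- (1 + c) * x))%:E))%E.
  apply: eq_integral => x _; rewrite -!EFinM mulrA mulVf ?gt_eqF// mul1r -expRD.
  by congr (expR _)%:E; ring.
rewrite ge0_integralZl//=; last 3 first.
- apply/measurable_EFinP/measurable_funM => //.
  by apply/measurable_funTS; apply: measurableT_comp => //; exact: measurable_funM.
- by move=> x _; rewrite lee_fin mulr_ge0 ?expR_ge0// ltW.
- by rewrite lee_fin invr_ge0 ltW.
by rewrite integral_expR_tail// mulr0 expR0 mule1.
Qed.

(** The expectation of a nonnegative variable is the integral of its tail, and the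
    tail of the excess over t is the exponential tail shifted by t. *)
Lemma integral_exp1_excess t : 0 <= t ->
  (\int[exp1]_x (Num.max 0 (x - t))%:E = (expR (- t))%:E)%E.
Proof.
move=> t0.
have mX : measurable_fun setT (fun x : measurableTypeR R => Num.max 0 (x - t)).
  by apply: measurable_maxr => //; exact: measurable_funB.
pose X : {RV exp1 >-> R} := HB.pack (fun x : measurableTypeR R => Num.max 0 (x - t))
  (isMeasurableFun.Build _ _ _ _ _ mX).
have := @ge0_expectation_ccdf _ _ _ exp1 X.
rewrite expectation_def => ->; last by move=> x; rewrite /X/= le_max lexx.
transitivity (\int[mu]_(x in `[0%R, +oo[)
    ((expR (- t))%:E * (1 * expR (- 1 * x))%:E))%E.
  apply: eq_integral => x; rewrite inE/= in_itv/= andbT => x0.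
  rewrite /ccdf /distribution /pushforward.
  rewrite (_ : _ @^-1` _ = `]t + x, +oo[%classic).
    by rewrite exp1_tail ?addr_ge0// -EFinM mul1r -expRD opprD mulN1r.
  apply/seteqP; split => z /=; rewrite !in_itv/= !andbT lt_max ltNge x0/=.
    by rewrite ltrBrDl.
  by rewrite ltrBrDl.
rewrite ge0_integralZl//=; last first.
  apply/measurable_EFinP/measurable_funM => //.
  by apply/measurable_funTS; apply: measurableT_comp => //; exact: measurable_funM.
by rewrite integral_expR_tail// mulr0 expR0 mule1.
Qed.

Lemma integral_exp1_sqr : (\int[exp1]_x (Num.max 0 x ^+ 2)%:E <= 32%:E)%E.
Proof.
apply: (@le_trans _ _ (\int[exp1]_x (16%:E * (expR (- (- 2^-1) * x))%:E))%E).
  apply: ge0_le_integral => //=.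
  - by move=> x _; rewrite lee_fin sqr_ge0.
  - by apply/measurable_EFinP; apply: measurable_funX; apply: measurable_maxr.
  - apply/measurable_EFinP; apply: measurable_funM => //.
    by apply: measurableT_comp => //; exact: measurable_funM.
  - move=> x _; rewrite lee_fin opprK.
    have [x0|x0] := leP 0 x; last by rewrite expr0n/= mulr_ge0// expR_ge0.
    (* exp (x/2) = exp (x/4)^2 >= (1 + x/4)^2 >= x^2/16 *)
    have -> : 2^-1 * x = x / 4 + x / 4 by field.
    rewrite expRD; have := expR_ge1Dx (x / 4); nra.
rewrite ge0_integralZl//; last first.
  apply/measurable_EFinP.
  by apply: measurableT_comp => //; exact: measurable_funM.
rewrite integral_exp1_expR; last by rewrite ltrN2 invf_lt1 ?ltr1n.
have -> : 1 - 2^-1 = 2^-1 :> R by field.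
by rewrite -EFinM lee_fin invrK -natrM.
Qed.

End Exponential.

(** * Joint laws of independent variables *)

Lemma measurable_funT_preimage {d1 d2 : measure_display} {T1 : measurableType d1}
    {T2 : measurableType d2} (f : T1 -> T2) (A : set T2) :
  measurable_fun setT f -> measurable A -> measurable (f @^-1` A).
Proof. by move=> mf mA; rewrite -[_ @^-1` _]setTI; exact: mf. Qed.

Section JointLaw.
Context {R : realType} {d d1 d2 : measure_display} {T : measurableType d}
  {T1 : measurableType d1} {T2 : measurableType d2}.
Variables (P : probability T R) (mu : probability T1 R) (nu : probability T2 R).
Variables (X : T -> T1) (Y : T -> T2).
Hypotheses (mX : measurable_fun setT X) (mY : measurable_fun setT Y).

(** Independence under the trace of P on E determines the joint law there, because
    rectangles generate the product sigma-algebra.  The event E records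
    conditions on the variables that are not being looked at. *)
Lemma joint_law (E : set T) : measurable E ->
  (forall A B, measurable A -> measurable B ->
     P (E `&` (X @^-1` A `&` Y @^-1` B)) = (P E * (mu A * nu B))%E) ->
  forall S, measurable S ->
    P (E `&` (fun w => (X w, Y w)) @^-1` S) = (P E * (mu \x nu)%E S)%E.
Proof.
move=> mE XY S mS.
have mXY : measurable_fun setT (fun w => (X w, Y w)) by exact: measurable_fun_pair.
have q0 : 0 <= fine (P E) by exact: fine_ge0.
pose q := NngNum q0.
have qE : P E = (q%:num)%:E by rewrite /= fineK// fin_num_measure.
pose m : {measure set (T1 * T2) -> \bar R} :=
  measure_function_pushforward__canonical__measure_function_Measure (mrestr P mE) mXY.
have -> : P (E `&` (fun w => (X w, Y w)) @^-1` S) = m S.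
  by rewrite /m /= /pushforward /mrestr setIC.
rewrite -(@product_measure_unique _ _ _ _ _ (mscale q mu) nu)//.
  rewrite /product_measure1 ge0_integral_mscale ?qE//.
  exact: measurable_fun_xsection.
move=> A B mA mB; rewrite /m /= /pushforward /mrestr setIC.
rewrite [X in E `&` X](_ : _ = X @^-1` A `&` Y @^-1` B)//.
by rewrite XY// /mscale -qE muleA.
Qed.

Lemma integral_joint_law :
  (forall A B, measurable A -> measurable B ->
     P (X @^-1` A `&` Y @^-1` B) = (mu A * nu B)%E) ->
  forall f : T1 * T2 -> \bar R, measurable_fun setT f -> (forall z, 0 <= f z)%E ->
    (\int[P]_w f (X w, Y w) = \int[mu]_x \int[nu]_y f (x, y))%E.
Proof.
move=> XY f mf f0.
have mXY : measurable_fun setT (fun w => (X w, Y w)) by exact: measurable_fun_pair.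
transitivity (\int[pushforward P (fun w => (X w, Y w))]_z f z)%E.
  by rewrite (ge0_integral_pushforward mXY).
rewrite -[RHS](fubini_tonelli1 f)//.
apply: eq_measure_integral => S mS _.
have := @joint_law setT measurableT _ S mS.
rewrite setTI probability_setT mul1e; apply => A B mA mB.
by rewrite setTI mul1e XY.
Qed.

End JointLaw.

Section IidExp.
Context {R : realType} {d : measure_display} {T : measurableType d}
  {I : choiceType}.
Variable P : probability T R.
Implicit Types (X : I -> T -> R) (s : seq I) (a b c : I).

(** The product rule is required for the whole list only; taking the full line for
    some of the sets yields it for sublists ([iid_exp_sub]). *)
Definition iid_exp s X := [/\ uniq s, (forall i, measurable_fun setT (X i)) &
  forall B : I -> set R, (forall i, measurable (B i)) ->
    P (\bigcap_(i in [set` s]) X i @^-1` B i) = (\prod_(i <- s) exp1 (B i))%E].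

Lemma iid_exp_sub s s' X : uniq s' -> {subset s' <= s} -> iid_exp s X -> iid_exp s' X.
Proof.
move=> us' ss' [us mX iX]; split => // B mB.
pose B' i := if (i \in s') then B i else setT.
have mB' i : measurable (B' i) by rewrite /B'; case: ifP.
have -> : \bigcap_(i in [set` s']) X i @^-1` B i = \bigcap_(i in [set` s]) X i @^-1` B' i.
  apply/seteqP; split => w /= h i.
    by move=> /= _; rewrite /B'; case: ifPn => // /h.
  by move=> /= is'; have := h i (ss' _ is'); rewrite /B'/= is'.
rewrite iX// (bigID (mem s'))/= [X in (_ * X)%E]big1 ?mule1; last first.
  by move=> i /negbTE is'; rewrite /B' is' probability_setT.
have pe : perm_eq [seq i <- s | i \in s'] s'.
  apply: uniq_perm; rewrite ?filter_uniq// => i; rewrite mem_filter.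
  by case: (boolP (i \in s')) => // /ss'.
rewrite -big_filter (perm_big _ pe).
by rewrite !big_seq; apply: eq_bigr => i is'; rewrite /B' is'.
Qed.

Lemma bigcap_cons_update a s X (A : set R) (B : I -> set R) : a \notin s ->
  \bigcap_(i in [set` a :: s]) X i @^-1` (if i == a then A else B i) =
  X a @^-1` A `&` \bigcap_(i in [set` s]) X i @^-1` B i.
Proof.
move=> as'; have neqa i : i \in s -> (i == a) = false.
  by apply: contraTF => /eqP ->.
apply/seteqP; split => [w ws|w [wa ws] i /=].
  split; first by have := ws a (mem_head a s); rewrite eqxx.
  move=> i /= is'; have := ws i; rewrite /= neqa//; apply.
  by rewrite in_cons is' orbT.
rewrite in_cons => /orP[/eqP->|is']; first by rewrite eqxx.
by rewrite neqa//; exact: ws.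
Qed.

Lemma iid_exp_cons a s X (A : set R) (B : I -> set R) : iid_exp (a :: s) X ->
  measurable A -> (forall i, measurable (B i)) ->
  P (X a @^-1` A `&` \bigcap_(i in [set` s]) X i @^-1` B i) =
  (exp1 A * P (\bigcap_(i in [set` s]) X i @^-1` B i))%E.
Proof.
move=> iX mA mB; have [/= /andP[as' us] mX iXE] := iX.
have sub : {subset s <= a :: s} by move=> i; rewrite in_cons orbC => ->.
have [_ _ ->//] := iid_exp_sub us sub iX.
rewrite -bigcap_cons_update// iXE; last by move=> i; case: ifP.
rewrite big_cons eqxx; congr (_ * _)%E.
rewrite !big_seq; apply: eq_bigr => i is'.
by have -> : (i == a) = false by apply: contraTF is' => /eqP ->.
Qed.

Lemma measurable_bigcap_preimage s X (B : I -> set R) :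
  (forall i, measurable_fun setT (X i)) -> (forall i, measurable (B i)) ->
  measurable (\bigcap_(i in [set` s]) X i @^-1` B i).
Proof.
move=> mX mB; apply: fin_bigcap_measurable => [|i _];
  [exact: finite_seq|exact: measurable_funT_preimage].
Qed.

End IidExp.

(** * The law of one Burke corner *)

Section BurkeTriple.
Context {R : realType}.
Implicit Types (a b u v z W : R).
Local Open Scope ereal_scope.

Let measurable_exp_branch (k q W : R) : measurable_fun [set: measurableTypeR R]
  (fun z => if (W < z)%R then (k * expR (q * z))%:E else 0).
Proof.
apply: measurable_fun_ifT => //; first exact: measurable_fun_ltr.
by apply/measurable_EFinP; apply: measurable_funM => //;
  apply: measurableT_comp => //; exact: measurable_funM.
Qed.

Let integral_exp1_branch a b W : (0 < a)%R -> (0 < b)%R -> (a^-1 + b^-1 = 1)%R ->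
  (0 <= W)%R ->
  \int[exp1]_z (if (W < z)%R then (b^-1 * expR (a^-1 * z))%:E else 0) =
  (expR (- (b^-1 * W)))%:E.
Proof.
move=> a0 b0 ab W0; have bV0 : (0 < b^-1)%R by rewrite invr_gt0.
rewrite integral_exp1//; last first.
  by move=> z; case: ifP => // _; rewrite lee_fin mulr_ge0 ?expR_ge0// ltW.
rewrite -mulNr -integral_expR_tail// -integral_itv_obnd_cbnd; last first.
  apply/measurable_EFinP/measurable_funM => //.
  by apply/measurable_funTS; apply: measurableT_comp => //; exact: measurable_funM.
rewrite [LHS]integral_mkcond [RHS]integral_mkcond; apply: eq_integral => x _.
rewrite !patchE !mem_setE !in_itv/= !andbT.
have [Wx|xW] := ltP W x; last by rewrite mul0e if_same.
rewrite (le_trans W0 (ltW Wx)) -EFinM -mulrA -expRD; congr (b^-1 * expR _)%:E%R.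
have -> : (b^-1 = 1 - a^-1)%R by rewrite -ab; ring.
by ring.
Qed.

(** The event that both new increments exceed given levels, written for the triple
    (bulk weight, (vertical, horizontal)) with increments a x and b y. *)
Definition burke_set a b u v : set (R * (R * R)) := [set t : R * (R * R) |
  (u < t.1 + Num.max 0 (a * t.2.2 - b * t.2.1))%R /\
  (v < t.1 + Num.max 0 (b * t.2.1 - a * t.2.2))%R].

Lemma measurable_burke_set a b u v : measurable (burke_set a b u v).
Proof.
have m1 : measurable_fun [set: R * (R * R)] (fst : R * (R * R) -> R).
  exact: measurable_fst.
have m21 : measurable_fun [set: R * (R * R)] (fun t : R * (R * R) => t.2.1).
  exact: measurableT_comp measurable_fst measurable_snd.
have m22 : measurable_fun [set: R * (R * R)] (fun t : R * (R * R) => t.2.2).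
  exact: measurableT_comp measurable_snd measurable_snd.
have mI (p q : R) (f g : R * (R * R) -> R) : measurable_fun setT f -> measurable_fun
  setT g ->
    measurable_fun setT (fun t : R * (R * R) => t.1 + Num.max 0 (p * f t - q * g t))%R.
  move=> mf mg; apply: measurable_funD => //; apply: measurable_maxr => //.
  by apply: measurable_funB; exact: measurable_funM.
pose I t := (t.1 + Num.max 0 (a * t.2.2 - b * t.2.1))%R : R.
pose J t := (t.1 + Num.max 0 (b * t.2.1 - a * t.2.2))%R : R.
have -> : burke_set a b u v = I @^-1` `]u, +oo[ `&` J @^-1` `]v, +oo[.
  by apply/seteqP; split => t /=; rewrite /burke_set/= !in_itv/= !andbT.
apply: measurableI; rewrite -[_ @^-1` _]setTI; apply: mI => //.
Qed.

Let xsection_burke_set a b u v z y :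
  xsection (xsection (burke_set a b u v) z) y = [set x |
    (u < z + Num.max 0 (a * x - b * y))%R /\ (v < z + Num.max 0 (b * y - a * x))%R].
Proof. by apply/seteqP; split => x; rewrite /xsection /burke_set /= inE/= inE/=. Qed.

(** For a bulk weight z above u both increments exceed their levels; for z at most
    v the smaller increment, which equals z, fails; in between the horizontal
    increment must exceed the vertical one by u - z. *)
Let burke_section a b u v z : (0 < a)%R -> (0 < b)%R -> (a^-1 + b^-1 = 1)%R ->
  (v <= u)%R ->
  (exp1 \x exp1) (xsection (burke_set a b u v) z) =
  if (u < z)%R then 1 else
  if (v < z)%R then (b^-1 * expR (a^-1 * z))%:E * (expR (- (a^-1 * u)))%:E else 0.
Proof.
move=> a0 b0 ab vu.
have max0 (p : R) : (0 <= Num.max 0 p)%R by rewrite le_max lexx.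
have [uz|zu] := ltP u z.
  have -> : xsection (burke_set a b u v) z = setT.
    apply/seteqP; split => // -[y x] _; rewrite /xsection /burke_set /= inE/=.
    have vz := le_lt_trans vu uz.
    by rewrite ltr_wpDr// ltr_wpDr.
  exact: probability_setT.
have [vz|zv] := ltP v z; last first.
  have -> : xsection (burke_set a b u v) z = set0.
    apply/seteqP; split => // -[y x]; rewrite /xsection /burke_set /= inE/= => -[].
    have [xy|xy] := leP (a * x - b * y)%R 0%R.
      by rewrite addr0 ltNge zu.
    by rewrite (max_idPl _) ?addr0 ?(ltNge v) ?zv//; lra.
  exact: measure0.
rewrite /product_measure1/=.
transitivity (\int[exp1]_y ((expR (- (a^-1 * (u - z))))%:E * (expR (- (b / a) * y))%:E)).
  rewrite [LHS]integral_exp1; last 2 first.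
  - by apply: measurable_fun_xsection; apply: measurable_xsection;
    exact: measurable_burke_set.
  - by move=> x; exact: measure_ge0.
  rewrite [RHS]integral_exp1; last 2 first.
  - apply: emeasurable_funM => //; apply/measurable_EFinP.
    by apply: measurableT_comp => //; exact: measurable_funM.
  - by move=> x; rewrite mule_ge0// lee_fin expR_ge0.
  apply: eq_integral => y; rewrite inE/= in_itv/= andbT => y0; congr (_ * _).
    rewrite xsection_burke_set (_ : [set _ | _] = `]((b * y + (u - z)) / a)%R,
      +oo[%classic); last first.
      apply/seteqP; split => x; rewrite /= in_itv/= andbT.
        move=> [h _]; rewrite ltr_pdivrMr// mulrC.
        move: h; have [h|h] := leP (a * x - b * y)%R 0%R; last by lra.
        by rewrite addr0 ltNge zu.
      rewrite ltr_pdivrMr// => h.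
      split; last by rewrite ltr_wpDr.
      by rewrite (max_idPr _); lra.
    rewrite exp1_tail; last first.
      by rewrite divr_ge0 ?(ltW a0)// addr_ge0 ?subr_ge0// mulr_ge0// ltW.
    rewrite -EFinM -expRD; congr (expR _)%:E.
    by field; rewrite gt_eqF.
rewrite ge0_integralZl//; last first.
  by apply/measurable_EFinP; apply: measurableT_comp => //; exact: measurable_funM.
have ba0 : (0 < b / a)%R by rewrite divr_gt0.
rewrite integral_exp1_expR; last by rewrite (lt_trans _ ba0)// ltrN10.
have -> : ((1 + b / a)^-1 = b^-1)%R.
  have e : (b * (a^-1 + b^-1) = b)%R by rewrite ab mulr1.
  by rewrite -[in RHS]e mulrDr mulfV ?gt_eqF// [in LHS]addrC.
rewrite -!EFinM -mulrA -expRD mulrC; congr (_ * expR _)%:E%R.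
by ring.
Qed.

(** Burke's property for one corner, on tails: the two new increments are
    independent with the laws of the old ones.  The case v <= u suffices, as the
    other one follows by exchanging the roles of rows and columns. *)
Lemma burke_set_law a b u v : (0 < a)%R -> (0 < b)%R -> (a^-1 + b^-1 = 1)%R ->
  (0 <= v)%R -> (v <= u)%R ->
  (exp1 \x (exp1 \x exp1)) (burke_set a b u v) =
  (expR (- (a^-1 * u)) * expR (- (b^-1 * v)))%:E.
Proof.
move=> a0 b0 ab v0 vu; have u0 := le_trans v0 vu.
pose h W z := if (W < z)%R then (b^-1 * expR (a^-1 * z))%:E else 0.
pose k := (expR (- (a^-1 * u)))%:E : \bar R.
pose g z := if (u < z)%R then 1 else if (v < z)%R then (b^-1 * expR (a^-1 * z))%:E * k
  else 0.
transitivity (\int[exp1]_z g z).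
  by apply: eq_integral => z _; exact: burke_section.
have h0 W z : 0 <= h W z.
  by rewrite /h; case: ifP => // _; rewrite lee_fin mulr_ge0 ?expR_ge0// invr_ge0 ltW.
have k0 : 0 <= k by rewrite lee_fin expR_ge0.
have mh W : measurable_fun [set: measurableTypeR R] (h W).
  exact: measurable_exp_branch.
have g0 z : 0 <= g z.
  rewrite /g; do 2?case: ifP => // _; rewrite mule_ge0// lee_fin mulr_ge0 ?expR_ge0//.
  by rewrite invr_ge0 ltW.
have mg : measurable_fun [set: measurableTypeR R] g.
  apply: measurable_fun_ifT => //; first exact: measurable_fun_ltr.
  apply: measurable_fun_ifT => //; first exact: measurable_fun_ltr.
  apply: emeasurable_funM => //; apply/measurable_EFinP; apply: measurable_funM => //.
  by apply: measurableT_comp => //; exact: measurable_funM.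
have ih W : (0 <= W)%R -> \int[exp1]_z (k * h W z) = k * (expR (- (b^-1 * W)))%:E.
  by move=> W0; rewrite ge0_integralZl// integral_exp1_branch.
have mkh W : measurable_fun [set: measurableTypeR R] (fun z => k * h W z).
  exact: emeasurable_funM.
have ind : \int[exp1]_z (\1_`]u, +oo[%classic z)%:E = (expR (- u))%:E.
  by rewrite integral_indic// setIT; exact: exp1_tail.
(* The bounded middle range is the difference of two tails; the subtracted tail
   is added on both sides. *)
have : \int[exp1]_z g z + \int[exp1]_z (k * h u z) =
    \int[exp1]_z (\1_`]u, +oo[%classic z)%:E + \int[exp1]_z (k * h v z).
  rewrite -!ge0_integralD//; try by move=> z _; rewrite mule_ge0.
    apply: eq_integral => z _; rewrite /g /h indicE mem_setE in_itv/= andbT.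
    have [uz|zu] := ltP u z; first by rewrite (le_lt_trans vu uz).
    by rewrite mule0 adde0 add0e; case: ifP => _; rewrite ?mule0// muleC.
  by apply/measurable_EFinP.
rewrite ind !ih//.
have -> : k * (expR (- (b^-1 * u)))%:E = (expR (- u))%:E.
  rewrite -EFinM -expRD -opprD -mulrDl ab mul1r//.
move/(congr1 (fun t => t - (expR (- u))%:E)).
by rewrite addeK// addeAC subee// add0e => ->.
Qed.

End BurkeTriple.

(** * Replacing corners in a family of independent exponentials *)

Section RayUniqueness.
Context {R : realType}.

(** Rays form an intersection-stable generating class; a ray that starts below 0
    is measured from 0, as the rest is null. *)
Lemma eq_measure_rays (m1 m2 : {measure set (measurableTypeR R) -> \bar R}) :
  (m1 setT < +oo)%E -> m1 `]-oo, 0]%classic = 0%E -> m2 `]-oo, 0]%classic = 0%E ->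
  (forall u : R, 0 <= u -> m1 `]u, +oo[%classic = m2 `]u, +oo[%classic) ->
  forall A, measurable A -> m1 A = m2 A.
Proof.
move=> m1oo m10 m20 m12 A mA.
have ray (m : {measure set (measurableTypeR R) -> \bar R}) (u : R) :
    m `]-oo, 0]%classic = 0%E ->
    m `]u, +oo[%classic = m `]Num.max u 0, +oo[%classic.
  move=> m0; have [//|u0] := leP 0 u.
  have -> : `]u, +oo[%classic = `]u, 0]%classic `|` `]0, +oo[%classic.
    by rewrite -itv_bndbnd_setU// bnd_simp ltW.
  rewrite measureU//; last first.
    apply/seteqP; split => // x [] /=; rewrite !in_itv/= andbT => /andP[_ x0].
    by rewrite ltNge x0.
  rewrite [X in (X + _)%E](_ : _ = 0%E) ?add0e//.
  apply/eqP; rewrite eq_le measure_ge0 andbT -m0.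
  by apply: le_measure; rewrite ?inE// => x /=; rewrite !in_itv/= => /andP[].
pose g (n : nat) : set R := `]- n%:R, +oo[%classic.
apply: (@measure_unique _ R (measurableTypeR R) (@RGenOInfty.G R) g _ _ _ _ m1 m2 _ _ A
  mA) => //.
- exact: RGenOInfty.measurableE.
- move=> _ _ [x ->] [y ->]; exists (Num.max x y).
  by apply/seteqP; split => z /=; rewrite !in_itv/= !andbT gt_max => /andP.
- by move=> n; exists (- n%:R).
- apply/seteqP; split => // x _.
  have [n xn] : exists n : nat, - x < n%:R.
    by exists (Num.truncn `|x|).+1; apply: le_lt_trans (ler_norm _) _;
      rewrite normrN truncnS_gt.
  by exists n => //=; rewrite /g /= in_itv/= andbT ltrNl.
- move=> _ [x ->]; apply: (etrans (ray m1 x m10)).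
  apply: (etrans _ (esym (ray m2 x m20))); apply: m12.
  by rewrite le_max lexx orbT.
- by move=> k; apply: le_lt_trans m1oo; apply: le_measure; rewrite ?inE//;
  exact: measurable_itv.
Qed.

End RayUniqueness.

Section BurkeFamily.
Context {R : realType} {d : measure_display} {T : measurableType d}.
Variable P : probability T R.

Lemma exp_law_of_tail (E : set T) (Z : T -> R) (q : \bar R) :
  measurable E -> measurable_fun setT Z -> (0 <= q)%E -> q \is a fin_num ->
  P (E `&` Z @^-1` `]-oo, 0]%classic) = 0%E ->
  (forall u, 0 <= u -> P (E `&` Z @^-1` `]u, +oo[%classic) = (q * (expR (- u))%:E)%E) ->
  forall A, measurable A -> P (E `&` Z @^-1` A) = (q * exp1 A)%E.
Proof.
move=> mE mZ q0 qfin Z0 Zu A mA.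
have fq0 : 0 <= fine q by exact: fine_ge0.
have mZ' : measurable_fun [set: T] (Z : T -> measurableTypeR R) by [].
pose m1 : {measure set (measurableTypeR R) -> \bar R} :=
  measure_function_pushforward__canonical__measure_function_Measure (mrestr P mE) mZ'.
have m1E B : m1 B = P (E `&` Z @^-1` B).
  by rewrite /m1 /= /pushforward /mrestr setIC.
have m2E B : mscale (NngNum fq0) exp1 B = (q * exp1 B)%E.
  by rewrite /mscale /= fineK.
rewrite -m1E -m2E; apply: (@eq_measure_rays _ m1 (mscale (NngNum fq0) exp1)) => //.
- by rewrite m1E ltey_eq fin_num_measure//; apply: measurableI => //;
  exact: measurable_funT_preimage.
- by rewrite m1E.
- by apply: (etrans (m2E _)); rewrite exp1_le0 mule0.
- move=> u u0; rewrite m1E Zu//; apply: (etrans _ (esym (m2E _))).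
  by rewrite exp1_tail.
Qed.

End BurkeFamily.

Section BurkeIid.
Context {R : realType} {d : measure_display} {T : measurableType d}
  {I : choiceType}.
Variable P : probability T R.
Implicit Types (X Z : I -> T -> R) (s : seq I) (i j c : I).

Lemma iid_exp_triple c j i s X (B : I -> set R) (S : set (R * (R * R))) :
  iid_exp P [:: c, j, i & s] X -> (forall k, measurable (B k)) -> measurable S ->
  P (\bigcap_(k in [set` s]) X k @^-1` B k `&` (fun w => (X c w, (X j w, X i w))) @^-1` S) =
  (P (\bigcap_(k in [set` s]) X k @^-1` B k) * (exp1 \x (exp1 \x exp1))%E S)%E.
Proof.
move=> iX mB mS; set E := \bigcap_(k in _) _.
have [/=] := iX; rewrite !in_cons !negb_or -!andbA.
move=> /and5P[cj ci cs ji /and3P[js si us]] mX _.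
have mE : measurable E by exact: measurable_bigcap_preimage.
have iX1 : iid_exp P [:: j, i & s] X.
  apply: iid_exp_sub iX; first by rewrite /= in_cons negb_or ji js si us.
  by move=> k; rewrite !in_cons => ->; rewrite orbT.
have iX2 : iid_exp P (i :: s) X.
  apply: iid_exp_sub iX1; first by rewrite /= si us.
  by move=> k; rewrite !in_cons => ->; rewrite orbT.
have three (A1 A2 A3 : set R) : measurable A1 -> measurable A2 -> measurable A3 ->
    P (X c @^-1` A1 `&` (X j @^-1` A2 `&` (X i @^-1` A3 `&` E))) =
    (exp1 A1 * (exp1 A2 * (exp1 A3 * P E)))%E.
  move=> mA1 mA2 mA3.
  have m3 k : measurable (if k == i then A3 else B k) by case: ifP.
  have m2 k : measurable (if k == j then A2 else if k == i then A3 else B k) by case: ifP.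
  rewrite -bigcap_cons_update// -bigcap_cons_update ?in_cons ?negb_or ?ji//.
  rewrite (iid_exp_cons iX)// bigcap_cons_update ?in_cons ?negb_or ?ji//.
  by rewrite (iid_exp_cons iX1)// bigcap_cons_update// (iid_exp_cons iX2).
have mji : measurable_fun setT (fun w => (X j w, X i w)) by exact: measurable_fun_pair.
have one A1 : measurable A1 -> P (E `&` X c @^-1` A1) = (P E * exp1 A1)%E.
  move=> mA1; have := three _ _ _ mA1 measurableT measurableT.
  by rewrite !preimage_setT !setTI !probability_setT !mul1e setIC muleC.
apply: (@joint_law _ _ _ _ _ _ _ P exp1 (exp1 \x exp1)%E (X c)
   (fun w => (X j w, X i w)) (mX c) mji E mE) => // A1 S' mA1 mS'.
rewrite setIA; have mEc : measurable (E `&` X c @^-1` A1).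
  by apply: measurableI => //; exact: measurable_funT_preimage.
rewrite (@joint_law _ _ _ _ _ _ _ P exp1 exp1 (X j) (X i) (mX j) (mX i) _ mEc)//.
  by rewrite one// muleA.
move=> A2 A3 mA2 mA3; rewrite one//.
have := three _ _ _ mA1 mA2 mA3.
rewrite (_ : _ `&` (_ `&` _) = E `&` X c @^-1` A1 `&` (X j @^-1` A2 `&` X i @^-1` A3)).
  by move=> ->; rewrite -muleA [in RHS]muleC -!muleA.
by apply/seteqP; split => w /=; tauto.
Qed.

(** Replacing the two standardized increments at a corner by the new ones, and
    dropping the bulk weight, preserves the product rule.  By [burke_set_law] it
    holds on pairs of rays; it is extended to all measurable sets in one coordinate
    after the other. *)
Lemma iid_exp_burke a b c j i s X Z : 0 < a -> 0 < b -> a^-1 + b^-1 = 1 ->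
  iid_exp P [:: c, j, i & s] X ->
  (forall w, Z i w = a^-1 * (X c w + Num.max 0 (a * X i w - b * X j w))) ->
  (forall w, Z j w = b^-1 * (X c w + Num.max 0 (b * X j w - a * X i w))) ->
  (forall k, k \in s -> Z k = X k) -> (forall k, measurable_fun setT (Z k)) ->
  iid_exp P [:: j, i & s] Z.
Proof.
move=> a0 b0 ab iX Zi Zj Zs mZ.
have [us mX _] := iX.
have us1 : uniq [:: j, i & s] by case/andP: us.
have := us; rewrite /= !in_cons !negb_or -!andbA.
move=> /and5P[cj ci cs ji /and3P[js si us2]].
split => // B mB.
pose E := \bigcap_(k in [set` s]) X k @^-1` B k.
have mE : measurable E by exact: measurable_bigcap_preimage.
have iXs : iid_exp P s X.
  by apply: iid_exp_sub iX => // k ks; rewrite !in_cons ks !orbT.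
have iXc : iid_exp P (c :: s) X.
  apply: iid_exp_sub iX; first by rewrite /= cs.
  by move=> k; rewrite !in_cons => /orP[->|->]; rewrite ?orbT.
have iX' : iid_exp P [:: c, i, j & s] X.
  apply: iid_exp_sub iX; last first.
    by move=> k; rewrite !in_cons => /or4P[]->; rewrite ?orbT.
  by rewrite /= !in_cons !negb_or cj ci cs (eq_sym i j) ji si js us2.
(* a new increment is at least the bulk weight, hence positive almost surely *)
have pos (Y : T -> R) p q : 0 < p -> (forall w, Y w = p^-1 * (X c w + Num.max 0 (q w))) ->
    measurable_fun setT Y -> forall F : set T, measurable F ->
    P (F `&` Y @^-1` `]-oo, 0]%classic) = 0%E.
  move=> p0 YE mY F mF; apply/eqP; rewrite eq_le measure_ge0 andbT.
  have <- : P (X c @^-1` `]-oo, 0]%classic) = 0%E.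
    have := iid_exp_cons iXc (measurable_itv `]-oo, 0]) (fun=> measurableT).
    by rewrite exp1_le0 mul0e => <-; congr (P _); apply/seteqP; split => w //= [].
  apply: le_measure; rewrite ?inE; [by apply: measurableI => //;
    exact: measurable_funT_preimage|exact: measurable_funT_preimage|].
  move=> w [_] /=; rewrite !in_itv/= YE pmulr_rle0 ?invr_gt0//.
  by apply: le_trans; rewrite lerDl le_max lexx.
have expE u v : (expR (- u) * expR (- v))%:E = ((expR (- u))%:E * (expR (- v))%:E)%E :>
  \bar R by [].
have rays u v : 0 <= u -> 0 <= v ->
    P ((E `&` Z j @^-1` `]v, +oo[%classic) `&` Z i @^-1` `]u, +oo[%classic) =
    (P E * (expR (- v))%:E * (expR (- u))%:E)%E.
  move=> u0 v0.
  have au0 : 0 <= a * u by rewrite mulr_ge0// ltW.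
  have bv0 : 0 <= b * v by rewrite mulr_ge0// ltW.
  have [le|/ltW le] := leP (b * v) (a * u).
    have := iid_exp_triple iX mB (measurable_burke_set a b (a * u) (b * v)).
    rewrite burke_set_law// !mulKf ?gt_eqF// expE muleA muleAC -/E => <-.
    congr (P _); rewrite -setIA; congr (_ `&` _); apply/seteqP; split => w;
      rewrite /burke_set /= !in_itv/= !andbT Zi Zj !ltr_pdivlMl//;
      by case.
  have ba : b^-1 + a^-1 = 1 by rewrite addrC.
  have := iid_exp_triple iX' mB (measurable_burke_set b a (b * v) (a * u)).
  rewrite burke_set_law// !mulKf ?gt_eqF// expE muleA -/E => <-.
  congr (P _); rewrite -setIA; congr (_ `&` _); apply/seteqP; split => w;
    rewrite /burke_set /= !in_itv/= !andbT Zi Zj !ltr_pdivlMl//;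
    by case.
have mEj v : measurable (E `&` Z j @^-1` `]v, +oo[%classic).
  by apply: measurableI => //; exact: measurable_funT_preimage.
have stage1 v A : 0 <= v -> measurable A ->
    P ((E `&` Z j @^-1` `]v, +oo[%classic) `&` Z i @^-1` A) =
    (P E * (expR (- v))%:E * exp1 A)%E.
  move=> v0 mA; apply: exp_law_of_tail => //.
  - by rewrite mule_ge0// lee_fin expR_ge0.
  - by rewrite fin_numM// fin_num_measure.
  - by apply: (pos _ a _ a0 Zi).
  - by move=> u u0; exact: rays.
have stage2 A A' : measurable A -> measurable A' ->
    P ((E `&` Z i @^-1` A) `&` Z j @^-1` A') = (P E * exp1 A * exp1 A')%E.
  move=> mA mA'; have mEi : measurable (E `&` Z i @^-1` A).
    by apply: measurableI => //; exact: measurable_funT_preimage.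
  apply: exp_law_of_tail => //.
  - by rewrite mule_ge0.
  - by rewrite fin_numM// fin_num_measure.
  - by apply: (pos _ b _ b0 Zj).
  - by move=> v v0; rewrite setIAC stage1// muleAC.
have -> : \bigcap_(k in [set` [:: j, i & s]]) Z k @^-1` B k =
    (E `&` Z i @^-1` B i) `&` Z j @^-1` B j.
  apply/seteqP; split => w.
    move=> h; split; last by apply: h; rewrite /= in_cons eqxx.
    split; last by apply: h; rewrite /= !in_cons eqxx orbT.
    by move=> k ks; rewrite /= -Zs//; apply: h; rewrite /= !in_cons [k \in s]ks !orbT.
  move=> [[hE hi] hj] k /=; rewrite !in_cons => /or3P[/eqP->//|/eqP->//|ks].
  by rewrite Zs//; exact: hE.
have [_ _ iE] := iXs.
rewrite stage2// /E iE// !big_cons muleC; congr (_ * _)%E; exact: muleC.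
Qed.

End BurkeIid.

Section BurkeFold.
Context {R : realType} {d : measure_display} {T : measurableType d}.
Variable P : probability T R.
Implicit Types (X : nat * nat -> T -> R) (bd l : seq (nat * nat)).

(** Along a whole sweep the boundary increments stay independent exponentials; the
    variables Z are these increments divided by their means. *)
Lemma iid_exp_burke_fold a b bd l X : 0 < a -> 0 < b -> a^-1 + b^-1 = 1 ->
  iid_exp P (bd ++ l) X -> (forall x w, 0 <= X x w) ->
  (forall c, c \in l -> [/\ (1 < c.1)%N, (1 < c.2)%N,
     (c.1, 1%N) \in bd & (1%N, c.2) \in bd]) ->
  exists Z, [/\ iid_exp P bd Z, (forall x w, 0 <= Z x w) &
    forall w, foldl burke_step (boundary a b (X^~ w)) l = boundary a b (Z^~ w)].
Proof.
move=> a0 b0 ab; elim: l X => [|c l IH] X iX X0 lbd.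
  by exists X; split => //; rewrite cats0 in iX.
have [c1 c2 ibd jbd] := lbd c (mem_head _ _).
pose i := (c.1, 1%N); pose j := (1%N, c.2).
pose Z x w := if x == i then a^-1 * (X c w + Num.max 0 (a * X i w - b * X j w))
  else if x == j then b^-1 * (X c w + Num.max 0 (b * X j w - a * X i w))
  else X x w.
have [uX mX _] := iX.
have ij : i != j by rewrite xpair_eqE negb_and; apply/orP; left; rewrite gtn_eqF.
have mI (k k' : R) x y : measurable_fun setT (fun w =>
  X c w + Num.max 0 (k * X x w - k' * X y w)).
  apply: measurable_funD => //; apply: measurable_maxr => //.
  by apply: measurable_funB; apply: measurable_funM.
have mZ x : measurable_fun setT (Z x).
  by rewrite /Z; case: (x == i); [|case: (x == j) => //]; exact: measurable_funM.
have [cbd ubl] : c \notin bd ++ l /\ uniq (bd ++ l).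
  by move: uX; rewrite uniq_catC cat_cons /= !mem_cat orbC uniq_catC => /andP[].
pose s := [seq x <- bd ++ l | x \notin [:: j; i]].
have us : uniq [:: j, i & s].
  rewrite /= filter_uniq// andbT !in_cons !mem_filter !in_cons !eqxx !orbT /= orbF andbT.
  by rewrite eq_sym.
have iXs : iid_exp P [:: c, j, i & s] X.
  apply: iid_exp_sub iX => [|x].
    rewrite cons_uniq us andbT !in_cons !negb_or mem_filter (negbTE cbd) andbF andbT.
    have jc : j \in bd ++ l by rewrite mem_cat jbd.
    have ic : i \in bd ++ l by rewrite mem_cat ibd.
    by apply/andP; split; apply: contraNneq cbd => ->.
  rewrite !in_cons mem_filter => /or4P[/eqP->|/eqP->|/eqP->|/andP[_]].
  - by rewrite mem_cat mem_head orbT.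
  - by rewrite mem_cat jbd.
  - by rewrite mem_cat ibd.
  - by rewrite !mem_cat in_cons => /orP[->//|->]; rewrite !orbT.
have iZ : iid_exp P [:: j, i & s] Z.
  apply: (iid_exp_burke a0 b0 ab iXs) => //.
  - by move=> w; rewrite /Z eqxx.
  - by move=> w; rewrite /Z eqxx eq_sym (negbTE ij).
  - move=> x; rewrite mem_filter !in_cons in_nil orbF negb_or => /andP[/andP[xj xi] _].
    by apply/funext => w; rewrite /Z (negbTE xi) (negbTE xj).
have iZ' : iid_exp P (bd ++ l) Z.
  apply: iid_exp_sub iZ => // x xbl.
  by rewrite !in_cons mem_filter xbl andbT !in_cons in_nil orbF; case: (x == j);
    case: (x == i).
have Z0 x w : 0 <= Z x w.
  rewrite /Z; do 2?case: ifP => _ //; rewrite mulr_ge0 ?invr_ge0 ?(ltW a0) ?(ltW b0)//;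
    by rewrite addr_ge0// le_max lexx.
have [x xl|V [iV V0 VE]] := IH Z iZ' Z0; first by apply: lbd; rewrite in_cons xl orbT.
exists V; split => // w; rewrite -VE /=; congr (foldl _ _ _).
have bi Y : boundary a b Y i = a * Y i by rewrite /boundary /= (gtn_eqF c1).
have bj Y : boundary a b Y j = b * Y j by rewrite /boundary /= (gtn_eqF c2).
have bc Y : boundary a b Y c = Y c.
  by rewrite /boundary (gtn_eqF c1) (gtn_eqF c2).
apply/funext => x; rewrite /burke_step -/i -/j !bi !bj !bc.
have [->|xi] := eqVneq x i; first by rewrite bi /Z eqxx mulVKf ?gt_eqF.
have [->|xj] := eqVneq x j.
  by rewrite bj /Z eqxx eq_sym (negbTE ij) mulVKf ?gt_eqF.
by rewrite /boundary /Z (negbTE xi) (negbTE xj).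
Qed.

End BurkeFold.

(** * Points where averages are close to their means *)

Section FatouPoint.
Context {R : realType} {d : measure_display} {T : measurableType d}.
Variable P : probability T R.

(** Otherwise V n w >= l + e for all large n, for almost every w, and Fatou's lemma
    would give l + e as a lower bound of the limit l of the bounds v. *)
Lemma frequently_below_mean (V : nat -> T -> R) (v : nat -> R) (l e : R) (Q : T -> Prop) :
  (forall n, measurable_fun setT (V n)) -> (forall n w, 0 <= V n w) ->
  (forall n, (\int[P]_w (V n w)%:E <= (v n)%:E)%E) -> v @ \oo --> l ->
  {ae P, forall w, Q w} -> 0 < e ->
  exists w, Q w /\ forall N, exists n, (N <= n)%N /\ V n w < l + e.
Proof.
move=> mV V0 Vv vl aeQ e0; apply: contrapT => none.
have ev w : Q w -> exists N, forall n, (N <= n)%N -> l + e <= V n w.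
  move=> Qw; apply: contrapT => noN; apply: none; exists w; split => // N.
  apply: contrapT => non; apply: noN; exists N => n Nn.
  by rewrite leNgt; apply/negP => lt; apply: non; exists n.
pose f n w := (V n w)%:E.
have mf n : measurable_fun setT (f n) by exact/measurable_EFinP.
have f0 n w : setT w -> (0 <= f n w)%E by rewrite lee_fin.
have l0 : 0 <= l.
  rewrite -(cvg_lim (@Rhausdorff R) vl); apply: limr_ge; first by apply/cvg_ex; exists l.
  near=> n.
  by rewrite -lee_fin; apply: le_trans (Vv n); apply: integral_ge0 => w _; rewrite lee_fin.
have := fatou P measurableT mf f0.
have : (limn_einf (fun n => \int[P]_w f n w) <= l%:E)%E.
  have vl' : (EFin \o v) @ \oo --> l%:E by apply: cvg_EFin vl; exact: nearW.
  rewrite limn_einf_lim -(cvg_lim _ vl')//; apply: lee_lim.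
  - exact: is_cvg_einfs.
  - by apply/cvg_ex; exists l%:E.
  - near=> n; apply: le_trans (Vv n); apply: ge_ereal_inf.
    by exists (\int[P]_w f n w)%E => //=; exists n => /=.
move=> le1 /le_trans-/(_ _ le1); apply/negP; rewrite -ltNge.
have einf0 w : (0 <= limn_einf (f^~ w))%E.
  rewrite limn_einf_lim; apply: lime_ge; first exact: is_cvg_einfs.
  by near=> n; apply: le_ereal_inf_tmp => _ [k _ <-]; exact: f0.
have meinf : measurable_fun setT (fun w => limn_einf (f^~ w)).
  apply: (emeasurable_fun_cvg (fun n w => einfs (f^~ w) n)).
    by move=> n; exact: measurable_fun_einfs.
  by move=> w _; rewrite limn_einf_lim; exact: is_cvg_einfs.
apply: (@lt_le_trans _ _ (l + e)%:E); first by rewrite lte_fin ltrDl.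
have -> : (l + e)%:E = (\int[P]_w (cst (l + e)%:E) w)%E.
  by rewrite integral_cst//= probability_setT mule1.
apply: ae_ge0_le_integral => //.
- by move=> w _; rewrite lee_fin addr_ge0// ltW.
- apply: filterS aeQ => w Qw _; have [N NV] := ev w Qw.
  rewrite limn_einf_lim; apply: lime_ge; first exact: is_cvg_einfs.
  near=> n; apply: le_ereal_inf_tmp => _ [k /= nk <-]; rewrite lee_fin; apply: NV.
  by apply: leq_trans nk; near: n; exact: nbhs_infty_ge.
Unshelve. all: by end_near. Qed.

End FatouPoint.

Section IidAverages.
Context {R : realType} {d : measure_display} {T : measurableType d}
  {I : choiceType}.
Variable P : probability T R.
Implicit Types (X : I -> T -> R) (i j : I) (s : seq I).
Local Open Scope ereal_scope.

Lemma iid_exp_law i X A : iid_exp P [:: i] X -> measurable A ->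
  P (X i @^-1` A) = exp1 A.
Proof.
move=> iX mA; have := iid_exp_cons iX mA (fun=> measurableT).
by rewrite set_nil bigcap_set0 setIT probability_setT mule1.
Qed.

Lemma integral_iid_exp i X (f : measurableTypeR R -> \bar R) : iid_exp P [:: i] X ->
  measurable_fun setT f -> (forall x, 0 <= f x) ->
  \int[P]_w f (X i w) = \int[exp1]_x f x.
Proof.
move=> iX mf f0; have [_ mX _] := iX.
have mXi : measurable_fun setT (X i : T -> measurableTypeR R) by exact: mX.
transitivity (\int[pushforward P (X i : T -> measurableTypeR R)]_x f x).
  by rewrite (ge0_integral_pushforward mXi).
apply: (eq_measure_integral exp1
  (m1 := measure_function_pushforward__canonical__measure_function_Measure P mXi)).
by move=> A mA _; exact: iid_exp_law.
Qed.

Lemma integral_iid_exp_pair i j X (f : R * R -> \bar R) : iid_exp P [:: i; j] X ->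
  measurable_fun [set: R * R] f -> (forall x, 0 <= f x) ->
  \int[P]_w f (X i w, X j w) = \int[exp1]_x \int[exp1]_y f (x, y).
Proof.
move=> iX mf f0; have [_ mX _] := iX.
apply: (@integral_joint_law _ _ _ _ _ _ _ P exp1 exp1 (X i) (X j) (mX i) (mX j)) =>
  // A B mA mB.
have iXj : iid_exp P [:: j] X.
  by apply: iid_exp_sub iX => // k; rewrite !in_cons => /orP[->|//]; rewrite orbT.
rewrite -(iid_exp_law iXj mB); have := iid_exp_cons iX mA (fun=> mB).
by rewrite set_cons1 !bigcap_set1.
Qed.

Lemma integral_exp1_id : \int[exp1]_x (Num.max 0%R x)%:E = 1 :> \bar R.
Proof.
by under eq_integral do rewrite -[X in Num.max _ X]subr0;
  rewrite integral_exp1_excess// oppr0 expR0.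
Qed.

Lemma expectation_iid_exp i X : iid_exp P [:: i] X -> (forall w, (0 <= X i w)%R) ->
  \int[P]_w (X i w)%:E = 1.
Proof.
move=> iX X0; rewrite -integral_exp1_id -(integral_iid_exp iX)//.
- by apply: eq_integral => w _; rewrite (max_idPr _).
- by apply/measurable_EFinP; exact: measurable_maxr.
- by move=> x; rewrite lee_fin le_max lexx.
Qed.

Lemma second_moment_iid_exp i X : iid_exp P [:: i] X -> (forall w, (0 <= X i w)%R) ->
  \int[P]_w (X i w ^+ 2)%:E <= 32%:E.
Proof.
move=> iX X0; apply: le_trans integral_exp1_sqr;
  rewrite -(integral_iid_exp iX (f := fun x => (Num.max 0 x ^+ 2)%:E))//.
- by rewrite le_eqVlt; apply/orP; left; apply/eqP; apply: eq_integral => w _;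
  rewrite (max_idPr _).
- by apply/measurable_EFinP; apply: measurable_funX; exact: measurable_maxr.
- by move=> x; rewrite lee_fin sqr_ge0.
Qed.

Lemma expectation_iid_exp_mul i j X : iid_exp P [:: i; j] X ->
  (forall k w, (0 <= X k w)%R) -> \int[P]_w (X i w * X j w)%:E = 1.
Proof.
move=> iX X0.
have mm : measurable_fun [set: R * R] (fun z : R * R => Num.max 0 z.1 * Num.max 0 z.2)%R.
  by apply: measurable_funM; apply: measurable_maxr => //; exact: measurable_snd.
transitivity (\int[P]_w (Num.max 0 (X i w) * Num.max 0 (X j w))%:E).
  by apply: eq_integral => w _; rewrite !(max_idPr _).
rewrite (integral_iid_exp_pair (f := fun z => (Num.max 0 z.1 * Num.max 0 z.2)%:E) iX)/=;
  last 2 first.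
- exact/measurable_EFinP.
- by move=> x; rewrite lee_fin mulr_ge0// le_max lexx.
transitivity (\int[exp1]_x (Num.max 0%R x)%:E : \bar R); last exact: integral_exp1_id.
apply: eq_integral => x _; under eq_integral do rewrite EFinM.
rewrite ge0_integralZl//.
- by rewrite integral_exp1_id mule1.
- by apply/measurable_EFinP; exact: measurable_maxr.
- by move=> y _; rewrite lee_fin le_max lexx.
- by rewrite lee_fin le_max lexx.
Qed.

End IidAverages.

Section LawOfLargeNumbers.
Context {R : realType} {d : measure_display} {T : measurableType d}
  {I : choiceType}.
Variable P : probability T R.
Implicit Types (X : I -> T -> R) (f : nat -> I).

(** The weak law of large numbers in mean square.  All integrands are kept
    nonnegative, with the cross term of the square moved to the other side, so that
    no integrability has to be checked. *)
Lemma iid_exp_average f n X : iid_exp P [seq f k | k <- iota 0 n.+1] X ->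
  (forall i w, 0 <= X i w) ->
  (\int[P]_w ((n.+1%:R^-1 * (\sum_(0 <= k < n.+1) X (f k) w) - 1) ^+ 2)%:E <=
   (32 / n.+1%:R)%:E)%E.
Proof.
move=> iX X0; have [uf mX _] := iX.
set N : R := n.+1%:R; have N0 : 0 < N by rewrite ltr0n.
have finj k l : (k < n.+1)%N -> (l < n.+1)%N -> k != l -> f k != f l.
  move=> kn ln; apply: contraNneq => fkl.
  have /uniqP := uf => /(_ (f 0%N) k l); rewrite !inE size_map size_iota.
  move=> /(_ kn ln) H; apply/eqP; apply: H.
  by rewrite !(nth_map 0%N) ?size_iota// !nth_iota.
have sub1 k : (k < n.+1)%N -> iid_exp P [:: f k] X.
  move=> kn; apply: iid_exp_sub iX => // i; rewrite mem_seq1 => /eqP->.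
  by apply: map_f; rewrite mem_iota.
have sub2 k l : (k < n.+1)%N -> (l < n.+1)%N -> k != l -> iid_exp P [:: f k; f l] X.
  move=> kn ln kl; apply: iid_exp_sub iX => [|i]; first by rewrite /= mem_seq1 finj.
  by rewrite mem_seq2 => /orP[]/eqP->; apply: map_f; rewrite mem_iota.
pose S w := \sum_(0 <= k < n.+1) X (f k) w.
have S0 w : 0 <= S w by exact: sumr_ge0.
have mS : measurable_fun setT S by exact: measurable_sum.
have intS : (\int[P]_w (N^-1 * S w)%:E = 1)%E.
  under eq_integral do rewrite EFinM.
  rewrite ge0_integralZl//; last 3 first.
  - exact/measurable_EFinP.
  - by move=> w _; rewrite lee_fin.
  - by rewrite lee_fin invr_ge0 ltW.
  under eq_integral do rewrite /S -sumEFin.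
  rewrite ge0_integral_sum//; last 2 first.
  - by move=> k; exact/measurable_EFinP.
  - by move=> k w _; rewrite lee_fin.
  rewrite (eq_big_nat _ _ (F2 := fun=> 1%E)); last first.
    by move=> k /andP[_ kn]; apply: expectation_iid_exp => //; exact: sub1.
  rewrite (_ : \sum_(_ <= _ < _) _ = N%:E)%E; last first.
    by rewrite sumEFin big_const_nat subn0 iter_addr_0.
  by rewrite -EFinM mulVf// gt_eqF.
have intSS : (\int[P]_w ((N^-1 * S w) ^+ 2)%:E <= (1 + 32 / N)%:E)%E.
  have e w : ((N^-1 * S w) ^+ 2)%:E = ((N^-1 ^+ 2)%:E *
      \sum_(0 <= k < n.+1) \sum_(0 <= l < n.+1) (X (f k) w * X (f l) w)%:E)%E.
    under eq_bigr do rewrite sumEFin.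
    rewrite sumEFin -EFinM exprMn; congr (_ * _)%:E.
    by rewrite expr2 /S mulr_suml; apply: eq_bigr => k _; rewrite mulr_sumr.
  under eq_integral do rewrite e.
  have mXX k l : measurable_fun setT (fun w => (X (f k) w * X (f l) w)%:E).
    by apply/measurable_EFinP; exact: measurable_funM.
  have mXS k : measurable_fun setT (fun w =>
    \sum_(0 <= l < n.+1) (X (f k) w * X (f l) w)%:E)%E.
    exact: emeasurable_sum.
  have XX0 k l w : (0 <= (X (f k) w * X (f l) w)%:E)%E by rewrite lee_fin mulr_ge0.
  rewrite ge0_integralZl//; last 3 first.
  - exact: emeasurable_sum.
  - by move=> w _; apply: sume_ge0 => k _; exact: sume_ge0.
  - by rewrite lee_fin sqr_ge0.
  rewrite ge0_integral_sum//; last by move=> k w _; exact: sume_ge0.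
  under eq_bigr do rewrite ge0_integral_sum//.
  apply: (@le_trans _ _ ((N^-1 ^+ 2)%:E *
      \sum_(0 <= k < n.+1) \sum_(0 <= l < n.+1) (1 + (if k == l then 32 else 0))%:E)%E).
    apply: lee_wpmul2l; first by rewrite lee_fin sqr_ge0.
    rewrite big_nat [leRHS]big_nat; apply: lee_sum => k /andP[_ kn].
    rewrite big_nat [leRHS]big_nat; apply: lee_sum => l /andP[_ ln].
    have [<-|kl] := eqVneq k l.
      under eq_integral do rewrite -expr2.
      apply: le_trans (second_moment_iid_exp (sub1 k kn) _) _ => //.
      by rewrite lee_fin lerDr.
    by rewrite (expectation_iid_exp_mul (sub2 k l kn ln kl))// addr0.
  under eq_bigr do rewrite sumEFin.
  rewrite sumEFin -EFinM lee_fin.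
  rewrite (eq_big_nat _ _ (F2 := fun=> N + 32)); last first.
    move=> k /andP[_ kn]; rewrite big_split/= big_const_nat subn0 iter_addr_0.
    congr (_ + _); rewrite -big_mkcond/= big_mkord.
    by rewrite (big_pred1 (Ordinal kn)).
  rewrite big_const_nat subn0 iter_addr_0 -mulr_natr -/N.
  by rewrite le_eqVlt; apply/orP; left; apply/eqP; field; rewrite gt_eqF.
have m1 : measurable_fun setT (fun w => N^-1 * S w) by exact: measurable_funM.
have split3 : (\int[P]_w ((N^-1 * S w - 1) ^+ 2)%:E + 2%:E =
    \int[P]_w ((N^-1 * S w) ^+ 2)%:E + 1)%E.
  have -> : 2%:E = (\int[P]_w (2%:E * (N^-1 * S w)%:E))%E.
    rewrite ge0_integralZl// ?intS ?mule1//; first exact/measurable_EFinP.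
    by move=> w _; rewrite lee_fin mulr_ge0// invr_ge0 ltW.
  have -> : 1%E = (\int[P]_w (cst 1 w))%E :> \bar R.
    by rewrite integral_cst//= probability_setT mule1.
  rewrite -!ge0_integralD//.
  - apply: eq_integral => w _; rewrite -EFinM /= -!EFinD; congr _%:E; ring.
  - by move=> w _; rewrite lee_fin sqr_ge0.
  - by apply/measurable_EFinP; exact: measurable_funX.
  - by move=> w _; rewrite lee_fin sqr_ge0.
  - by apply/measurable_EFinP/measurable_funX/measurable_funB.
  - by move=> w _; rewrite -EFinM lee_fin !mulr_ge0// invr_ge0 ltW.
  - by apply: emeasurable_funM => //; exact/measurable_EFinP.
rewrite -/N -(leeD2rE (x := 2%:E))// split3.
apply: le_trans (leeD2r _ intSS) _.
rewrite -!EFinD lee_fin (_ : 1 + _ + 1 = 32 / N + 2)//; ring.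
Qed.

End LawOfLargeNumbers.

Section MeanLowerBound.
Context {R : realType} {d : measure_display} {T : measurableType d}.
Variable P : probability T R.

(** Means bound values from below once second moments are bounded.  Applied to the
    nonnegative variable eta (Z - 1/(2 eta))^2 = eta Z^2 - Z + 1/(4 eta), whose mean is
    at most eta C - m + 1/(4 eta), [frequently_below_mean] yields Z > m - e for small
    eta. *)
Lemma frequently_above_mean (Z : nat -> T -> R) (m C e : R) (Q : T -> Prop) :
  (forall n, measurable_fun setT (Z n)) -> (forall n w, 0 <= Z n w) ->
  (forall n, \int[P]_w (Z n w)%:E = m%:E)%E ->
  (forall n, \int[P]_w (Z n w ^+ 2)%:E <= C%:E)%E ->
  {ae P, forall w, Q w} -> 0 < e ->
  exists w, Q w /\ forall N, exists n, (N <= n)%N /\ m - e < Z n w.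
Proof.
move=> mZ Z0 Zm ZC aeQ e0.
have C0 : 0 <= C.
  rewrite -lee_fin; apply: le_trans (ZC 0%N); apply: integral_ge0 => w _.
  by rewrite lee_fin sqr_ge0.
(* so that eta C <= e/2 *)
pose eta := e / (2 * (C + 1)).
have C1 : 0 < C + 1 by rewrite ltr_wpDl.
have eta0 : 0 < eta by rewrite divr_gt0// mulr_gt0.
have etaC : eta * C <= e / 2.
  rewrite /eta invfM mulrA -[leRHS]mulr1 -mulrA ler_wpM2l ?divr_ge0 ?(ltW e0)//.
  by rewrite ler_pdivrMl// mulr1 lerDl.
pose V n w := eta * (Z n w - (2 * eta)^-1) ^+ 2.
have mV n : measurable_fun setT (V n).
  by apply: measurable_funM => //; apply: measurable_funX; exact: measurable_funB.
have V0 n w : 0 <= V n w by rewrite mulr_ge0 ?sqr_ge0// ltW.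
have VE n w : V n w + Z n w = eta * Z n w ^+ 2 + (4 * eta)^-1.
  by rewrite /V; field; rewrite gt_eqF.
have Vv n : (\int[P]_w (V n w)%:E <= (eta * C + (4 * eta)^-1 - m)%:E)%E.
  rewrite EFinB leeBrDr// -(Zm n) -ge0_integralD//; last 4 first.
  - by move=> w _; rewrite lee_fin.
  - exact/measurable_EFinP.
  - by move=> w _; rewrite lee_fin.
  - exact/measurable_EFinP.
  under eq_integral do rewrite -EFinD VE EFinD EFinM.
  rewrite ge0_integralD//; last 3 first.
  - by move=> w _; rewrite mule_ge0// lee_fin ?sqr_ge0// ltW.
  - by apply: emeasurable_funM => //; apply/measurable_EFinP; exact: measurable_funX.
  - by move=> w _; rewrite lee_fin invr_ge0 mulr_ge0// ltW.
  rewrite integral_cst//= probability_setT mule1 EFinD leeD2r//.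
  rewrite ge0_integralZl//; last 3 first.
  - by apply/measurable_EFinP; exact: measurable_funX.
  - by move=> w _; rewrite lee_fin sqr_ge0.
  - by rewrite lee_fin ltW.
  by rewrite (EFinM eta C) lee_wpmul2l// lee_fin ltW.
have e20 : 0 < e / 2 by rewrite divr_gt0.
have [w [Qw wV]] := frequently_below_mean mV V0 Vv (cvg_cst _) aeQ e20.
exists w; split => // N; have [n [Nn Vn]] := wV N; exists n; split => //.
have := VE n w; have : 0 <= eta * Z n w ^+ 2 by rewrite mulr_ge0 ?sqr_ge0// ltW.
by lra.
Qed.

End MeanLowerBound.

(** The Cauchy-Schwarz inequality, from 2 x y <= x^2 + y^2 term by term. *)
Lemma sqr_average_le {R : realFieldType} (a : nat -> R) n :
  (n.+1%:R^-1 * \sum_(0 <= k < n.+1) a k) ^+ 2 <=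
  n.+1%:R^-1 * \sum_(0 <= k < n.+1) a k ^+ 2.
Proof.
set N : R := n.+1%:R; have N0 : 0 < N by rewrite ltr0n.
set S := \sum_(0 <= k < n.+1) a k; set S2 := \sum_(0 <= k < n.+1) a k ^+ 2.
suff le : S ^+ 2 <= N * S2.
  by rewrite exprMn expr2 -mulrA ler_pM2l ?invr_gt0// ler_pdivrMl.
have -> : N * S2 = \sum_(0 <= k < n.+1) \sum_(0 <= l < n.+1) (a k ^+ 2 + a l ^+ 2) / 2.
  under eq_bigr do rewrite -mulr_suml big_split/= big_const_nat subn0 iter_addr_0 -[_
    ^+ 2 *+ _]mulr_natl.
  by rewrite -mulr_suml big_split/= -mulr_sumr big_const_nat subn0 iter_addr_0 -[_ *+
    n.+1]mulr_natl -/N -/S2; field.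
rewrite expr2 {1}/S mulr_suml; apply: ler_sum => k _.
rewrite mulr_sumr; apply: ler_sum => l _.
have := sqr_ge0 (a k - a l); nra.
Qed.

Section SignPairs.
Context {R : realType} {d : measure_display} {T : measurableType d}
  {I : choiceType}.
Variable P : probability T R.
Implicit Types (X : I -> T -> R) (i j k l p q : I) (c : R) (s : seq I).
Local Open Scope ereal_scope.

Lemma measurable_excess c : measurable_fun [set: R * R]
  (fun z : R * R => (Num.max 0 (z.2 - c * z.1))%R%:E).
Proof.
apply/measurable_EFinP; apply: measurable_maxr => //; apply: measurable_funB.
  exact: measurable_snd.
by apply: measurable_funM => //; exact: measurable_fst.
Qed.

(** By lack of memory the mean excess over c x is exp (- c x), whose mean is
    1/(1 + c). *)
Lemma exp1_pair_excess c : (0 <= c)%R ->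
  \int[exp1]_x \int[exp1]_y (Num.max 0 (y - c * x))%R%:E = (1 + c)^-1%R%:E :> \bar R.
Proof.
move=> c0; have f0 (z : R * R) : 0 <= (Num.max 0 (z.2 - c * z.1))%R%:E.
  by rewrite lee_fin le_max lexx.
have c1 : (-1 < c)%R by rewrite (lt_le_trans _ c0)// ltrN10.
rewrite integral_exp1; last 2 first.
- exact: (measurable_fun_fubini_tonelli_F (m2 := exp1) _ (measurable_excess c) f0).
- by move=> x; apply: integral_ge0 => y _; exact: (f0 (x, y)).
rewrite -(integral_exp1_expR c1) [RHS]integral_exp1; last 2 first.
- by apply/measurable_EFinP; apply: measurableT_comp => //; exact: measurable_funM.
- by move=> x; rewrite lee_fin expR_ge0.
apply: eq_integral => x; rewrite inE/= in_itv/= andbT => x0.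
by rewrite integral_exp1_excess ?mulr_ge0// mulNr.
Qed.

Definition exp2 : probability (measurableTypeR R * measurableTypeR R)%type R :=
  (exp1 \x exp1).

Definition ascending : set (R * R) := [set z : R * R | (z.1 < z.2)%R].

Lemma measurable_ascending : measurable ascending.
Proof.
have -> : ascending = (fun z : R * R => z.2 - z.1)%R @^-1` `]0%R, +oo[%classic.
  by apply/seteqP; split => z; rewrite /ascending /= in_itv/= andbT subr_gt0.
by rewrite -[_ @^-1` _]setTI; apply: measurable_funB.
Qed.

Lemma exp1_pair_ascending : exp2 ascending = 2^-1%R%:E.
Proof.
rewrite /exp2 /= /product_measure1 integral_exp1; last 2 first.
- by apply: measurable_fun_xsection; exact: measurable_ascending.
- by move=> x; exact: measure_ge0.
have c1 : (-1 < 1 :> R)%R by rewrite (lt_trans (ltrN10 _)).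
transitivity ((1 + 1)^-1%R%:E : \bar R); last by [].
rewrite -(integral_exp1_expR c1) [RHS]integral_exp1; last 2 first.
- by apply/measurable_EFinP; apply: measurableT_comp => //; exact: measurable_funM.
- by move=> x; rewrite lee_fin expR_ge0.
apply: eq_integral => x; rewrite inE/= in_itv/= andbT => x0; congr (_ * _).
rewrite (_ : xsection _ _ = `]x, +oo[%classic) ?exp1_tail ?mulN1r//.
by apply/seteqP; split => y; rewrite /xsection /ascending /= inE/= in_itv/= andbT.
Qed.

Lemma exp1_pair_ascendingC : exp2 (~` ascending) = 2^-1%R%:E.
Proof.
apply: (etrans (probability_setC exp2 measurable_ascending)).
apply: (etrans (congr1 (fun t => 1 - t) exp1_pair_ascending)).
by rewrite -EFinB; congr _%:E; field.
Qed.

Let indep_event (E : set T) (q : \bar R) s X := measurable E /\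
  forall B : I -> set R, (forall i, measurable (B i)) ->
    P (E `&` \bigcap_(i in [set` s]) X i @^-1` B i) = q * \prod_(i <- s) exp1 (B i).

(** Two variables of the list can be moved into the event, whatever the planar set
    to which they are constrained. *)
Let indep_event_pair E (q0 : \bar R) i j s X (S : set (R * R)) : uniq [:: i, j & s] ->
  (forall i, measurable_fun setT (X i)) -> measurable S ->
  indep_event E q0 [:: i, j & s] X ->
  indep_event (E `&` (fun w => (X i w, X j w)) @^-1` S) (q0 * exp2 S) s X.
Proof.
rewrite /= in_cons negb_or -andbA => /and4P[ij is' js us] mX mS [mE EX].
have mXX : measurable_fun setT (fun w => (X i w, X j w)) by exact: measurable_fun_pair.
split; first by apply: measurableI => //; rewrite -[_ @^-1` _]setTI; exact: mXX.
move=> B mB; set F := \bigcap_(k in _) _.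
have mEF : measurable (E `&` F).
  by apply: measurableI => //; exact: measurable_bigcap_preimage.
have rect A1 A2 : measurable A1 -> measurable A2 ->
    P (E `&` F `&` (X i @^-1` A1 `&` X j @^-1` A2)) =
    q0 * (exp1 A1 * (exp1 A2 * \prod_(k <- s) exp1 (B k))).
  move=> mA1 mA2.
  pose B' k := if k == i then A1 else if k == j then A2 else B k.
  have mB' k : measurable (B' k) by rewrite /B'; do 2?case: ifP.
  have := EX B' mB'; rewrite bigcap_cons_update ?in_cons ?negb_or ?ij//.
  rewrite bigcap_cons_update// -/F => EE.
  rewrite (_ : _ `&` _ = E `&` (X i @^-1` A1 `&` (X j @^-1` A2 `&` F))); last first.
    by apply/seteqP; split => w /=; tauto.
  rewrite EE !big_cons /B' !eqxx eq_sym (negbTE ij); congr (_ * (_ * (_ * _))).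
  rewrite !big_seq; apply: eq_bigr => k ks.
  have -> : (k == i) = false by apply: contraNF is' => /eqP <-.
  by have -> : (k == j) = false by apply: contraNF js => /eqP <-.
have PEF : P (E `&` F) = q0 * \prod_(k <- s) exp1 (B k).
  have := rect _ _ measurableT measurableT.
  by rewrite !preimage_setT !setIT !probability_setT !mul1e.
rewrite setIAC (@joint_law _ _ _ _ _ _ _ P exp1 exp1 (X i) (X j) (mX i) (mX j) _ mEF)//.
  by rewrite PEF muleAC.
move=> A1 A2 mA1 mA2; rewrite rect// PEF.
by rewrite -!muleA; congr (_ * _); rewrite [in RHS]muleC -!muleA.
Qed.

(** Three disjoint pairs of variables are independent, so that the mean of the
    product is the product of the means. *)
Lemma integral_two_signs i j k l p q X (S1 S2 : set (R * R)) c :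
  iid_exp P [:: i; j; k; l; p; q] X -> (0 <= c)%R ->
  measurable S1 -> measurable S2 ->
  exp2 S1 = 2^-1%R%:E -> exp2 S2 = 2^-1%R%:E ->
  \int[P]_w (\1_S1 (X i w, X j w) * (\1_S2 (X k w, X l w) *
     Num.max 0 (X q w - c * X p w)))%R%:E = (4^-1 * (1 + c)^-1)%R%:E.
Proof.
move=> iX c0 mS1 mS2 S1E S2E; have [uX mX PX] := iX.
have mV a b : measurable_fun setT (fun w => (X a w, X b w)) by exact: measurable_fun_pair.
have start : indep_event setT 1 [:: i; j; k; l; p; q] X.
  by split => // B mB; rewrite setTI mul1e PX.
have three A1 A2 A3 : measurable A1 -> measurable A2 -> measurable A3 ->
    P ((fun w => (X i w, X j w)) @^-1` A1 `&` ((fun w => (X k w, X l w)) @^-1` A2 `&`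
      (fun w => (X p w, X q w)) @^-1` A3)) =
    exp2 A1 * (exp2 A2 * exp2 A3).
  move=> mA1 mA2 mA3.
  have uX2 : uniq [:: k; l; p; q] by move: uX => /and3P[].
  have uX3 : uniq [:: p; q] by move: uX2 => /and3P[].
  have [_ H] := indep_event_pair uX3 mX mA3 (indep_event_pair uX2 mX mA2
    (indep_event_pair uX mX mA1 start)).
  have := H (fun=> setT) (fun=> measurableT).
  by rewrite big_nil mule1 set_nil bigcap_set0 setIT setTI mul1e -setIA muleA.
have sep1 A1 : measurable A1 -> P ((fun w => (X i w, X j w)) @^-1` A1) = exp2 A1.
  move=> mA1; have := three _ _ _ mA1 measurableT measurableT.
  by rewrite !preimage_setT !setIT !probability_setT !mule1.
have mE A1 : measurable A1 -> measurable ((fun w => (X i w, X j w)) @^-1` A1).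
  by move=> mA1; rewrite -[_ @^-1` _]setTI; exact: mV.
have mW : measurable_fun setT (fun w => ((X k w, X l w), (X p w, X q w))).
  exact: measurable_fun_pair.
have mind S : measurable S -> measurable_fun setT (\1_S : R * R -> R).
  by move=> mS; exact: measurable_indic.
pose g (z : R * R) : \bar R := (Num.max 0 (z.2 - c * z.1))%R%:E.
have g0 z : 0 <= g z by rewrite lee_fin le_max lexx.
have mg : measurable_fun setT g := measurable_excess c.
pose h (z : (R * R) * (R * R)) := (\1_S2 z.1)%:E * g z.2.
have mh : measurable_fun setT h.
  apply: emeasurable_funM; last exact: measurableT_comp mg measurable_snd.
  by apply/measurable_EFinP; exact: measurableT_comp (mind S2 mS2) measurable_fst.
have h0 z : 0 <= h z by rewrite mule_ge0// lee_fin.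
pose f (z : (R * R) * ((R * R) * (R * R))) := (\1_S1 z.1)%:E * h z.2.
have mf : measurable_fun setT f.
  apply: emeasurable_funM; last exact: measurableT_comp mh measurable_snd.
  by apply/measurable_EFinP; exact: measurableT_comp (mind S1 mS1) measurable_fst.
have f0 z : 0 <= f z by rewrite mule_ge0// lee_fin.
have ind (S : set (R * R)) : measurable S -> exp2 S = 2^-1%R%:E ->
    \int[exp2]_z (\1_S z)%:E = 2^-1%R%:E.
  by move=> mS SE; rewrite integral_indic// setIT.
have ig : \int[exp2]_z g z = (1 + c)^-1%R%:E.
  apply: (etrans (@fubini_tonelli1 _ _ _ _ _ exp1 exp1 g mg g0)).
  exact: exp1_pair_excess.
have ih : \int[exp2 \x exp2]_z h z = (2^-1 * (1 + c)^-1)%R%:E.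
  apply: (etrans (@fubini_tonelli1 _ _ _ _ _ exp2 exp2 h mh h0)).
  transitivity (\int[exp2]_z ((\1_S2 z)%:E * (1 + c)^-1%R%:E)).
    apply: eq_integral => z _; rewrite /fubini_F /h /= ge0_integralZl//.
      by rewrite ig.
  rewrite ge0_integralZr ?ind//; first by apply/measurable_EFinP; exact: mind.
  by rewrite lee_fin invr_ge0 addr_ge0.
transitivity (\int[P]_w f ((X i w, X j w), ((X k w, X l w), (X p w, X q w)))).
  by apply: eq_integral => w _; rewrite /f /h /g /= !EFinM.
rewrite (@integral_joint_law _ _ _ _ _ _ _ P exp2 (exp2 \x exp2)
  (fun w => (X i w, X j w)) (fun w => ((X k w, X l w), (X p w, X q w))) (mV i j) mW)//.
  transitivity (\int[exp2]_z ((\1_S1 z)%:E * (2^-1 * (1 + c)^-1)%R%:E)).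
    apply: eq_integral => z _; rewrite -ih.
    transitivity (\int[exp2 \x exp2]_y ((\1_S1 z)%:E * h y)); first by [].
    have k0 : 0 <= (\1_S1 z)%:E :> \bar R by rewrite lee_fin.
    exact: (@ge0_integralZl _ _ _ (exp2 \x exp2) setT measurableT h mh (\1_S1 z)%:E
      (fun z _ => h0 z) k0).
  rewrite ge0_integralZr ?ind//.
  - by rewrite -EFinM; congr _%:E; field; rewrite gt_eqF// ltr_wpDr.
  - by apply/measurable_EFinP; exact: mind.
  - by rewrite lee_fin mulr_ge0// invr_ge0 addr_ge0.
move=> A B mA mB.
rewrite (@joint_law _ _ _ _ _ _ _ P exp2 exp2 _ _ (mV k l) (mV p q) _ (mE _ mA))//.
  by congr (_ * _); exact: sep1.
move=> A2 A3 mA2 mA3; rewrite three//.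
by congr (_ * _); rewrite sep1.
Qed.

End SignPairs.

(** * The greedy mean *)

Section IidField.
Context {R : realType} {d : measure_display} {T : measurableType d}.
Variable P : probability T R.
Variable Z : nat * nat -> T -> R.
Hypothesis Z0 : forall x w, 0 <= Z x w.
Hypothesis mZ : forall x, measurable_fun setT (Z x).
Hypothesis iidZ : forall s, uniq s -> (forall x, x \in s -> sites x) -> iid_exp P s Z.

Lemma measurable_boundary a b x : measurable_fun setT (fun w => boundary a b (Z^~ w) x).
Proof.
rewrite /boundary; case: (x.2 == 1%N); case: (x.1 == 1%N) => //;
  exact: measurable_funM.
Qed.

Lemma measurable_lpp (y : T -> nat * nat -> R) i j :
  (forall x, measurable_fun setT (y^~ x)) ->
  measurable_fun setT (fun w => lpp (y w) i j).
Proof.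
move=> my; move: i j; apply: lpp_ind => [//|i|i j mi mj].
  by under eq_fun do rewrite lpp0; exact: measurable_cst.
under eq_fun do rewrite lppSS.
by apply: measurable_funD => //; exact: measurable_maxr.
Qed.

Section Greedy.
Variable r : R.
Hypothesis r0 : 0 < r.

Let gainE k w : greedy_gain r (Z^~ w) k =
  Z (k.+2, k.+3) w + Num.max 0 (Z (k.+3, k.+2) w - 1 * Z (k.+2, k.+3) w) +
  r^-1 * Z (k.+2, k.+2) w +
  (\1_ascending (Z (k.+2, k.+1) w, Z (k.+1, k.+2) w) *
     (\1_ascending (Z (k.+3, k.+2) w, Z (k.+2, k.+3) w) *
       Num.max 0 (Z (k.+1, k.+3) w - r^-1 * Z (k.+2, k.+2) w)) +
   \1_(~` ascending) (Z (k.+2, k.+1) w, Z (k.+1, k.+2) w) *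
     (\1_(~` ascending) (Z (k.+3, k.+2) w, Z (k.+2, k.+3) w) *
       Num.max 0 (Z (k.+3, k.+1) w - r^-1 * Z (k.+2, k.+2) w))).
Proof.
rewrite /greedy_gain /upward; congr (_ + _ + _).
  by rewrite mul1r max0_subr [RHS]addrC subrK maxC.
have asc (a b : R) : (\1_ascending (a, b) : R) = (a < b)%R%:R.
  by rewrite indicE; congr (_%:R : R); congr nat_of_bool; apply/idP/idP; rewrite inE.
have ascC (a b : R) : (\1_(~` ascending) (a, b) : R) = (~~ (a < b)%R)%:R.
  rewrite indicE; congr (_%:R : R); congr nat_of_bool; apply/idP/idP; rewrite inE /=.
    by move=> /negP.
  by move=> /negP.
rewrite !asc !ascC.
by congr (_ + _); do 2 case: ltP => _ /=; rewrite ?mul1r ?mul0r.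
Qed.

Lemma measurable_greedy_gain k : measurable_fun setT (fun w => greedy_gain r (Z^~ w) k).
Proof.
under eq_fun do rewrite gainE.
have mex c x y : measurable_fun setT (fun w => Num.max 0 (Z x w - c * Z y w)).
  by apply: measurable_maxr => //; apply: measurable_funB => //; exact: measurable_funM.
have mind (S : set (R * R)) x y : measurable S ->
    measurable_fun setT (fun w => \1_S (Z x w, Z y w) : R).
  move=> mS; have m1 : measurable_fun setT (\1_S : R * R -> R) by exact: measurable_indic.
  by apply: (measurableT_comp m1); exact: measurable_fun_pair.
have mA := @measurable_ascending R.
have mAC := measurableC mA.
apply: measurable_funD; apply: measurable_funD.
- by apply: measurable_funD => //; exact: mex.
- exact: measurable_funM.
- apply: measurable_funM; first exact: mind.
  by apply: measurable_funM; [exact: mind|exact: mex].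
- apply: measurable_funM; first exact: mind.
  by apply: measurable_funM; [exact: mind|exact: mex].
Qed.

Lemma greedy_gain_ge0 k w : 0 <= greedy_gain r (Z^~ w) k.
Proof.
have rV0 : 0 <= r^-1 by rewrite invr_ge0 ltW.
rewrite /greedy_gain !addr_ge0 ?mulr_ge0 ?le_max ?Z0//;
  by case: ifP => // _; rewrite le_max lexx.
Qed.

Lemma greedy_gain_mean k : (\int[P]_w (greedy_gain r (Z^~ w) k)%:E =
  (3 / 2 + (r ^+ 2 + 2 * (1 + r)) / (2 * r * (1 + r)))%:E)%E.
Proof.
have rV0 : 0 <= r^-1 by rewrite invr_ge0 ltW.
have iid1 x : sites x -> iid_exp P [:: x] Z.
  by move=> sx; apply: iidZ => // y; rewrite mem_seq1 => /eqP->.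
pose ex c x y w := Num.max 0 (Z x w - c * Z y w).
have mex c x y : measurable_fun setT (ex c x y).
  by apply: measurable_maxr => //; apply: measurable_funB => //; exact: measurable_funM.
have ex0 c x y w : 0 <= ex c x y w by rewrite le_max lexx.
pose sg (S : set (R * R)) x y x' y' c p q w : R :=
  \1_S (Z x w, Z y w) * (\1_S (Z x' w, Z y' w) * ex c q p w).
have msg S x y x' y' c p q : measurable S -> measurable_fun setT (sg S x y x' y' c p q).
  move=> mS; have m1 : measurable_fun setT (\1_S : R * R -> R) by exact: measurable_indic.
  have mi u v : measurable_fun setT (fun w => \1_S (Z u w, Z v w) : R).
    by apply: (measurableT_comp m1); exact: measurable_fun_pair.
  by apply: measurable_funM => //; exact: measurable_funM.
have sg0 S x y x' y' c p q w : 0 <= sg S x y x' y' c p q w by rewrite !mulr_ge0.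
have mA := @measurable_ascending R; have mAC := measurableC mA.
have intmax : (\int[P]_w (ex 1 (k.+3, k.+2) (k.+2, k.+3) w)%:E = (2^-1 : R)%:E)%E.
  rewrite (integral_iid_exp_pair (i := (k.+2, k.+3)) (j := (k.+3, k.+2))
    (f := fun z => (Num.max 0 (z.2 - 1 * z.1))%:E)).
  - by rewrite exp1_pair_excess.
  - apply: iidZ; first by rewrite /= mem_seq1 xpair_eqE; lia.
    by move=> x; rewrite mem_seq2 => /orP[]/eqP->.
  - exact: measurable_excess.
  - by move=> z; rewrite lee_fin le_max lexx.
have intsg S q : measurable S -> exp2 S = (2^-1 : R)%:E -> sites q ->
    uniq [:: (k.+2, k.+1); (k.+1, k.+2); (k.+3, k.+2); (k.+2, k.+3); (k.+2, k.+2); q] ->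
    (\int[P]_w (sg S (k.+2, k.+1) (k.+1, k.+2) (k.+3, k.+2) (k.+2, k.+3) r^-1 (k.+2,
      k.+2) q w)%:E
     = (4^-1 * (1 + r^-1)^-1)%:E)%E.
  move=> mS SE sq us; apply: integral_two_signs => //; apply: iidZ => // x.
  by rewrite !in_cons in_nil orbF => /or4P[/eqP->|/eqP->|/eqP->|/or3P[]/eqP->].
under eq_integral do rewrite gainE.
transitivity (\int[P]_w ((Z (k.+2, k.+3) w)%:E + (ex 1 (k.+3, k.+2) (k.+2, k.+3) w)%:E +
  (r^-1)%:E * (Z (k.+2, k.+2) w)%:E +
  ((sg ascending (k.+2, k.+1) (k.+1, k.+2) (k.+3, k.+2) (k.+2, k.+3) r^-1 (k.+2,
    k.+2) (k.+1, k.+3) w)%:E +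
   (sg (~` ascending) (k.+2, k.+1) (k.+1, k.+2) (k.+3, k.+2) (k.+2, k.+3) r^-1 (k.+2,
     k.+2) (k.+3, k.+1) w)%:E))%E)%E.
  by apply: eq_integral => w _; rewrite -EFinM -!EFinD.
have mrZ : measurable_fun setT (fun w => (r^-1)%:E * (Z (k.+2, k.+2) w)%:E)%E.
  by apply: emeasurable_funM => //; exact/measurable_EFinP.
have rZ0 w : (0 <= (r^-1)%:E * (Z (k.+2, k.+2) w)%:E)%E by rewrite mule_ge0 ?lee_fin.
have mE (h : T -> R) : measurable_fun setT h -> measurable_fun setT (EFin \o h).
  by move=> ?; exact/measurable_EFinP.
rewrite ge0_integralD//; last 4 first.
- by move=> w _; rewrite !adde_ge0 ?rZ0 ?lee_fin ?Z0 ?ex0 ?sg0.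
- by do 2?apply: emeasurable_funD => //; apply: mE.
- by move=> w _; rewrite !adde_ge0 ?rZ0 ?lee_fin ?Z0 ?ex0 ?sg0.
- by apply: emeasurable_funD; apply: mE; exact: msg.
rewrite ge0_integralD//; last 2 first.
- by move=> w _; rewrite !adde_ge0 ?rZ0 ?lee_fin ?Z0 ?ex0 ?sg0.
- by apply: emeasurable_funD; apply: mE.
rewrite ge0_integralD//; last 4 first.
- by move=> w _; rewrite lee_fin.
- exact: mE.
- by move=> w _; rewrite lee_fin.
- exact: mE.
rewrite ge0_integralD//; last 4 first.
- by move=> w _; rewrite lee_fin.
- by apply: mE; exact: msg.
- by move=> w _; rewrite lee_fin.
- by apply: mE; exact: msg.
rewrite ge0_integralZl//; last 2 first.
- exact: mE.
- by move=> w _; rewrite lee_fin.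
have uq i j : ((i == k.+1) && (j == k.+3)) || ((i == k.+3) && (j == k.+1)) ->
    uniq [:: (k.+2, k.+1); (k.+1, k.+2); (k.+3, k.+2); (k.+2, k.+3); (k.+2, k.+2); (i, j)].
  by move=> /orP[]/andP[/eqP-> /eqP->]; rewrite /= !in_cons !in_nil !xpair_eqE; lia.
rewrite intmax !intsg//; try (by apply: uq; lia); last 2 first.
- exact: exp1_pair_ascendingC.
- exact: exp1_pair_ascending.
rewrite !expectation_iid_exp//; try exact: iid1.
rewrite mule1 -!EFinD; congr _%:E; field.
by rewrite !gt_eqF// ?addr_gt0.
Qed.

(** The gain is at most a sum of five weights. *)
Lemma greedy_gain_sqr k : (\int[P]_w (greedy_gain r (Z^~ w) k ^+ 2)%:E <=
  (160 * (4 + r^-1 ^+ 2))%:E)%E.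
Proof.
have rV0 : 0 <= r^-1 by rewrite invr_ge0 ltW.
pose l := [:: (k.+2, k.+3); (k.+3, k.+2); (k.+1, k.+3); (k.+3, k.+1)].
have sq x : sites x -> (\int[P]_w (Z x w ^+ 2)%:E <= 32%:E)%E.
  move=> sx; apply: second_moment_iid_exp => //.
  by apply: iidZ => // y; rewrite mem_seq1 => /eqP->.
have m2 x : measurable_fun setT (fun w => (Z x w ^+ 2)%:E).
  by apply/measurable_EFinP; exact: measurable_funX.
apply: (@le_trans _ _ (\int[P]_w ((5 * r^-1 ^+ 2)%:E * (Z (k.+2, k.+2) w ^+ 2)%:E +
   5%:E * \sum_(x <- l) (Z x w ^+ 2)%:E)%E)%E).
  apply: ge0_le_integral => //.
  - by move=> w _; rewrite lee_fin sqr_ge0.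
  - by apply/measurable_EFinP; apply: measurable_funX; exact: measurable_greedy_gain.
  - apply: emeasurable_funD; apply: emeasurable_funM => //; exact: emeasurable_sum.
  - move=> w _; rewrite sumEFin -!EFinM -EFinD lee_fin /l !big_cons big_nil.
    have := greedy_gain_ge0 k w; rewrite /greedy_gain.
    set a := Z (k.+2, k.+3) w; set b := Z (k.+3, k.+2) w; set c := Z (k.+2, k.+2) w.
    set e := Z (k.+1, k.+3) w; set f := Z (k.+3, k.+1) w.
    set g := _ + _ + _ => g0.
    have a0 : 0 <= a by exact: Z0.
    have b0 : 0 <= b by exact: Z0.
    have e0 : 0 <= e by exact: Z0.
    have f0 : 0 <= f by exact: Z0.
    have rc0 : 0 <= r^-1 * c by rewrite mulr_ge0// Z0.
    have le : g <= a + b + r^-1 * c + e + f.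
      rewrite /g; move: rc0; set rc := r^-1 * c => rc0.
      have e1 : Num.max 0 (e - rc) <= e by rewrite ge_max e0 gerBl.
      have f1 : Num.max 0 (f - rc) <= f by rewrite ge_max f0 gerBl.
      have ab1 : Num.max a b <= a + b by rewrite ge_max lerDl b0 lerDr a0.
      by do 2 case: ifP => _; lra.
    have -> : 5 * r^-1 ^+ 2 * c ^+ 2 + 5 * (a ^+ 2 + (b ^+ 2 + (e ^+ 2 + (f ^+ 2 + 0)))) =
        5 * ((r^-1 * c) ^+ 2 + a ^+ 2 + b ^+ 2 + e ^+ 2 + f ^+ 2) by ring.
    apply: (@le_trans _ _ ((a + b + r^-1 * c + e + f) ^+ 2)).
      by rewrite lerXn2r ?nnegrE//; lra.
    set p := r^-1 * c.
    rewrite -subr_ge0 [X in 0 <= X](_ : _ = (a - b) ^+ 2 + (a - p) ^+ 2 + (a - e) ^+ 2 +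
      (a - f) ^+ 2 + (b - p) ^+ 2 + (b - e) ^+ 2 + (b - f) ^+ 2 + (p - e) ^+ 2 +
      (p - f) ^+ 2 + (e - f) ^+ 2); last by ring.
    by rewrite !addr_ge0 ?sqr_ge0.
rewrite ge0_integralD//; last 4 first.
- by move=> w _; rewrite mule_ge0// lee_fin ?sqr_ge0// mulr_ge0// sqr_ge0.
- exact: emeasurable_funM.
- by move=> w _; rewrite mule_ge0// sume_ge0// => x _; rewrite lee_fin sqr_ge0.
- by apply: emeasurable_funM => //; exact: emeasurable_sum.
rewrite ge0_integralZl//; last 2 first.
- by move=> w _; rewrite lee_fin sqr_ge0.
- by rewrite lee_fin mulr_ge0// sqr_ge0.
rewrite ge0_integralZl//; last 2 first.
- exact: emeasurable_sum.
- by move=> w _; rewrite sume_ge0// => x _; rewrite lee_fin sqr_ge0.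
rewrite ge0_integral_sum//; last by move=> x w _; rewrite lee_fin sqr_ge0.
apply: (@le_trans _ _ ((5 * r^-1 ^+ 2)%:E * 32%:E + 5%:E * \sum_(x <- l) 32%:E)%E).
  apply: leeD; apply: lee_wpmul2l; rewrite ?lee_fin ?mulr_ge0 ?sqr_ge0//; first exact: sq.
  rewrite big_seq [leRHS]big_seq; apply: lee_sum => x.
  by rewrite /l !in_cons in_nil orbF => /or4P[]/eqP->; exact: sq.
rewrite sumEFin -!EFinM -EFinD lee_fin /l !big_cons big_nil.
by rewrite le_eqVlt; apply/orP; left; apply/eqP; ring.
Qed.

Lemma frequently_above_greedy_mean (m e : R) (Q : T -> Prop) :
  m = 3 / 2 + (r ^+ 2 + 2 * (1 + r)) / (2 * r * (1 + r)) ->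
  {ae P, forall w, Q w} -> 0 < e ->
  exists w, Q w /\ forall N, exists n, (N <= n)%N /\
    m - e < n.+1%:R^-1 * lpp (slowed r (Z^~ w)) n.+3 n.+3.
Proof.
move=> mE aeQ e0.
pose V n w := n.+1%:R^-1 * \sum_(0 <= k < n.+1) greedy_gain r (Z^~ w) k.
have mS n : measurable_fun setT (fun w => \sum_(0 <= k < n) greedy_gain r (Z^~ w) k).
  by apply: measurable_sum => k; exact: measurable_greedy_gain.
have mV n : measurable_fun setT (V n) by exact: measurable_funM.
have N0 n : 0 <= n.+1%:R^-1 :> R by rewrite invr_ge0.
have V0 n w : 0 <= V n w.
  by rewrite mulr_ge0// sumr_ge0// => k _; exact: greedy_gain_ge0.
have sumconst n (c : R) : (\sum_(0 <= k < n.+1) c%:E)%E = (n.+1%:R * c)%:E.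
  by rewrite sumEFin big_const_nat subn0 iter_addr_0 mulr_natl.
have mg k : measurable_fun setT (fun w => (greedy_gain r (Z^~ w) k)%:E).
  by apply/measurable_EFinP; exact: measurable_greedy_gain.
have Vm n : (\int[P]_w (V n w)%:E = m%:E)%E.
  under eq_integral do rewrite EFinM -sumEFin.
  rewrite ge0_integralZl//; last 2 first.
  - exact: emeasurable_sum.
  - by move=> w _; apply: sume_ge0 => k _; rewrite lee_fin greedy_gain_ge0.
  rewrite ge0_integral_sum//; last by move=> k w _; rewrite lee_fin greedy_gain_ge0.
  under eq_bigr do rewrite greedy_gain_mean -mE.
  by rewrite sumconst -EFinM mulKf.
have mg2 k : measurable_fun setT (fun w => (greedy_gain r (Z^~ w) k ^+ 2)%:E).
  by apply/measurable_EFinP; apply: measurable_funX; exact: measurable_greedy_gain.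
have V2 n : (\int[P]_w (V n w ^+ 2)%:E <= (160 * (4 + r^-1 ^+ 2))%:E)%E.
  apply: (@le_trans _ _ (\int[P]_w ((n.+1%:R^-1)%:E *
      \sum_(0 <= k < n.+1) (greedy_gain r (Z^~ w) k ^+ 2)%:E)%E)%E).
    apply: ge0_le_integral => //.
    - by move=> w _; rewrite lee_fin sqr_ge0.
    - by apply/measurable_EFinP; exact: measurable_funX.
    - by apply: emeasurable_funM => //; exact: emeasurable_sum.
    - by move=> w _; rewrite sumEFin -EFinM lee_fin; exact: sqr_average_le.
  rewrite ge0_integralZl//; last 2 first.
  - exact: emeasurable_sum.
  - by move=> w _; apply: sume_ge0 => k _; rewrite lee_fin sqr_ge0.
  rewrite ge0_integral_sum//; last by move=> k w _; rewrite lee_fin sqr_ge0.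
  apply: (@le_trans _ _ ((n.+1%:R^-1)%:E * \sum_(0 <= k < n.+1) (160 * (4 +
    r^-1 ^+ 2))%:E)%E).
    apply: lee_wpmul2l; first by rewrite lee_fin.
    by apply: lee_sum => k _; exact: greedy_gain_sqr.
  by rewrite sumconst -EFinM mulKf.
have [w [Qw wV]] := frequently_above_mean mV V0 Vm V2 aeQ e0.
exists w; split => // N; have [n [Nn Vn]] := wV N; exists n; split => //.
apply: lt_le_trans Vn _; rewrite ler_wpM2l//.
by apply: greedy_le_lpp => // x; exact: Z0.
Qed.

End Greedy.
End IidField.

(** * The stationary passage time *)

Lemma mem_bulk n x : (x \in bulk n) = (1 < x.1 < n.+2)%N && (1 < x.2 < n.+2)%N.
Proof.
rewrite /bulk; apply/flatten_mapP/idP => [[j]|].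
  rewrite mem_iota => jn /mapP[i]; rewrite mem_iota => iin ->/=; lia.
case: x => i j /= /andP[iin jn]; exists j; first by rewrite mem_iota; lia.
by apply/mapP; exists i => //; rewrite mem_iota; lia.
Qed.

Lemma bulk_uniq n : uniq (bulk n).
Proof.
apply: (allpairs_uniq (f := fun j i => (i, j))); try exact: iota_uniq.
by move=> [a b] [a' b'] _ _ /= [-> ->].
Qed.

Section Stationary.
Context {R : realType} {d : measure_display} {T : measurableType d}.
Variable P : probability T R.
Variable Z : nat * nat -> T -> R.
Hypothesis Z0 : forall x w, 0 <= Z x w.
Hypothesis mZ : forall x, measurable_fun setT (Z x).
Hypothesis iidZ : forall s, uniq s -> (forall x, x \in s -> sites x) -> iid_exp P s Z.

(** The weight of the corner is subtracted: it cancels when passage times with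
    different multipliers are compared. *)
Definition deviation a b n w : R := n.+1%:R^-1 *
  (lpp (boundary a b (Z^~ w)) n.+2 n.+2 - Z (1, 1)%N w) - (a + b).

Lemma measurable_deviation a b n : measurable_fun setT (deviation a b n).
Proof.
apply: measurable_funB => //; apply: measurable_funM => //.
apply: measurable_funB => //; apply: measurable_lpp => x.
exact: measurable_boundary.
Qed.

(** By [lpp_burke] the passage time is a sum over the first column plus a sum
    over the top row, and by [iid_exp_burke_fold] both consist of independent
    exponentials, of means b and a. *)
Lemma deviation_sqr a b n : 0 < a -> 0 < b -> a^-1 + b^-1 = 1 ->
  (\int[P]_w (deviation a b n w ^+ 2)%:E <=
   (64 * (a ^+ 2 + b ^+ 2) * harmonic n)%:E)%E.
Proof.
move=> a0 b0 ab.
pose fi k := (k.+2, 1%N); pose fj k := (1%N, k.+2).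
pose bdi := [seq fi k | k <- iota 0 n.+1]; pose bdj := [seq fj k | k <- iota 0 n.+1].
pose bd := bdi ++ bdj.
have mbdi x : x \in bdi -> (1 < x.1)%N /\ x.2 = 1%N by move=> /mapP[k _ ->].
have mbdj x : x \in bdj -> x.1 = 1%N /\ (1 < x.2)%N by move=> /mapP[k _ ->].
have ubdi : uniq bdi by rewrite map_inj_uniq ?iota_uniq// => k l [].
have ubdj : uniq bdj by rewrite map_inj_uniq ?iota_uniq// => k l [].
have ubd : uniq bd.
  rewrite cat_uniq ubdi ubdj andTb andbT; apply/hasPn => x /mbdj[x1 _].
  by apply/negP => /mbdi[]; rewrite x1.
have iX : iid_exp P (bd ++ bulk n.+1) Z.
  apply: iidZ.
    rewrite cat_uniq ubd bulk_uniq andTb andbT; apply/hasPn => x; rewrite mem_bulk => xb.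
    by rewrite mem_cat; apply/negP => /orP[/mbdi[]|/mbdj[]]; lia.
  move=> x; rewrite mem_cat => /orP[|]; last by rewrite mem_bulk /sites /=; lia.
  rewrite mem_cat => /orP[/mbdi[x1 x2]|/mbdj[x1 x2]]; split.
  - exact: ltnW x1.
  - by rewrite x2.
  - by rewrite x1.
  - exact: ltnW x2.
have bdE c : c \in bulk n.+1 -> [/\ (1 < c.1)%N, (1 < c.2)%N, (c.1, 1%N) \in bd & (1%N,
  c.2) \in bd].
  rewrite mem_bulk => /andP[/andP[c1 c1n] /andP[c2 c2n]]; split => //.
    rewrite mem_cat; apply/orP; left; apply/mapP; exists c.1.-2;
      first by rewrite mem_iota; lia.
    by rewrite /fi; congr pair; lia.
  rewrite mem_cat; apply/orP; right; apply/mapP; exists c.2.-2;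
    first by rewrite mem_iota; lia.
  by rewrite /fj; congr pair; lia.
have [V [iV V0 VE]] := iid_exp_burke_fold a0 b0 ab iX Z0 bdE.
have iVi : iid_exp P [seq fi k | k <- iota 0 n.+1] V.
  by apply: iid_exp_sub iV => // x; rewrite mem_cat => ->.
have iZj : iid_exp P [seq fj k | k <- iota 0 n.+1] Z.
  by apply: iid_exp_sub iX => // x xj; rewrite !mem_cat xj orbT.
have [_ mV _] := iV.
pose ai w := n.+1%:R^-1 * (\sum_(0 <= k < n.+1) V (fi k) w) - 1.
pose aj w := n.+1%:R^-1 * (\sum_(0 <= k < n.+1) Z (fj k) w) - 1.
have N0 : n.+1%:R != 0 :> R by rewrite pnatr_eq0.
have devE w : deviation a b n w = a * ai w + b * aj w.
  rewrite /deviation lpp_burke; last first.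
    by move=> x; apply: boundary_ge0 (ltW a0) (ltW b0) (Z0 _ _).
  rewrite VE big_nat_recl// /boundary/= -mulr_sumr -mulr_sumr /ai /aj /fi /fj.
  by field.
have mavg (W : nat * nat -> T -> R) f : (forall x, measurable_fun setT (W x)) ->
    measurable_fun setT (fun w => (n.+1%:R^-1 * (\sum_(0 <= k < n.+1) W (f k) w) - 1) ^+ 2).
  move=> mW; apply: measurable_funX; apply: measurable_funB => //.
  by apply: measurable_funM => //; apply: measurable_sum => k; exact: mW.
apply: (@le_trans _ _ (\int[P]_w ((2 * a ^+ 2)%:E * (ai w ^+ 2)%:E +
    (2 * b ^+ 2)%:E * (aj w ^+ 2)%:E))%E).
  apply: ge0_le_integral => //.
  - by move=> w _; rewrite lee_fin sqr_ge0.
  - by apply/measurable_EFinP; apply: measurable_funX; exact: measurable_deviation.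
  - apply: emeasurable_funD; apply: emeasurable_funM => //; apply/measurable_EFinP;
      exact: mavg.
  - move=> w _; rewrite devE -!EFinM -EFinD lee_fin -subr_ge0.
    rewrite [X in 0 <= X](_ : _ = (a * ai w - b * aj w) ^+ 2) ?sqr_ge0//; ring.
have mi : measurable_fun setT (fun w => (ai w ^+ 2)%:E) by apply/measurable_EFinP;
  exact: mavg.
have mj : measurable_fun setT (fun w => (aj w ^+ 2)%:E) by apply/measurable_EFinP;
  exact: mavg.
have a2 : 0 <= 2 * a ^+ 2 by rewrite mulr_ge0// sqr_ge0.
have b2 : 0 <= 2 * b ^+ 2 by rewrite mulr_ge0// sqr_ge0.
rewrite ge0_integralD//; last 4 first.
- by move=> w _; rewrite mule_ge0// lee_fin ?sqr_ge0.
- exact: emeasurable_funM.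
- by move=> w _; rewrite mule_ge0// lee_fin ?sqr_ge0.
- exact: emeasurable_funM.
rewrite !ge0_integralZl//; try (by move=> w _; rewrite lee_fin sqr_ge0).
have li := iid_exp_average iVi V0; have lj := iid_exp_average iZj Z0.
apply: (@le_trans _ _ ((2 * a ^+ 2)%:E * (32 / n.+1%:R)%:E +
  (2 * b ^+ 2)%:E * (32 / n.+1%:R)%:E)%E).
  by apply: leeD; apply: lee_wpmul2l; rewrite ?lee_fin.
rewrite -!EFinM -EFinD lee_fin /harmonic/=.
by rewrite le_eqVlt; apply/orP; left; apply/eqP; field.
Qed.

End Stationary.

(** * Bounds on the time constant *)

Section Limits.
Context {R : realType}.
Implicit Types (u : nat -> R) (a l : R).

Lemma frequently_le_limit u l a : u @ \oo --> l ->
  (forall N, exists n, (N <= n)%N /\ a <= u n) -> a <= l.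
Proof.
move=> ul freq; rewrite leNgt; apply/negP => la.
have [N _ uN] := cvgr_lt _ ul _ la.
by have [n [Nn]] := freq N; rewrite leNgt uN.
Qed.

Lemma limit_le_frequently u l a : u @ \oo --> l ->
  (forall N, exists n, (N <= n)%N /\ u n <= a) -> l <= a.
Proof.
move=> ul freq; rewrite leNgt; apply/negP => la.
have [N _ uN] := cvgr_gt _ ul _ la.
by have [n [Nn]] := freq N; rewrite leNgt uN.
Qed.

(** Squares of side n + q.+1 are compared with averages of n.+1 variables. *)
Lemma cvg_shifted_ratio u l q : (fun n => n%:R^-1 * u n) @ \oo --> l ->
  (fun n => n.+1%:R^-1 * u (n + q.+1)%N) @ \oo --> l.
Proof.
move=> ul.
have ulq : (fun n => (n + q.+1)%:R^-1 * u (n + q.+1)%N) @ \oo --> l.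
  by move: ul; rewrite -(cvg_shiftn q.+1).
have oneq : (fun n => 1 + q%:R * harmonic n) @ \oo --> (1 : R).
  rewrite -[X in _ --> X]addr0 -[X in _ --> _ + X](mulr0 q%:R).
  by apply: cvgD; [exact: cvg_cst|apply: cvgM; [exact: cvg_cst|exact: cvg_harmonic]].
have lim := cvgM oneq ulq; rewrite mul1r in lim.
suff -> : (fun n => n.+1%:R^-1 * u (n + q.+1)%N) =
    (fun n => 1 + q%:R * harmonic n) \* (fun n => (n + q.+1)%:R^-1 * u (n + q.+1)%N).
  exact: lim.
apply/funext => n; rewrite /harmonic /= mulrA; congr (_ * _).
rewrite addnS -addSn natrD.
have n0 : n.+1%:R != 0 :> R by rewrite pnatr_eq0.
have nq0 : n.+1%:R + q%:R != 0 :> R by rewrite -natrD pnatr_eq0.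
by move: (n.+1%:R : R) (q%:R : R) n0 nq0 => x y x0 xy0; field; rewrite x0 xy0.
Qed.

End Limits.

Section TimeConstant.
Context {R : realType} {d : measure_display} {T : measurableType d}.
Variable P : probability T R.
Variable Z : nat * nat -> T -> R.
Hypothesis Z0 : forall x w, 0 <= Z x w.
Hypothesis mZ : forall x, measurable_fun setT (Z x).
Hypothesis iidZ : forall s, uniq s -> (forall x, x \in s -> sites x) -> iid_exp P s Z.
Variable kappa : R -> R.

Let conv r w := (fun n => n%:R^-1 * lpp (slowed r (Z^~ w)) n n) @ \oo --> kappa r.

Hypothesis kappaZ : forall r, 0 < r <= 1 -> {ae P, forall w, conv r w}.

Lemma kappa_nonincreasing r1 r2 : 0 < r1 -> r1 <= r2 -> r2 <= 1 -> kappa r2 <= kappa r1.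
Proof.
move=> r10 r12 r21.
have r11 : 0 < r1 <= 1 by rewrite r10 (le_trans r12).
have r22 : 0 < r2 <= 1 by rewrite (lt_le_trans r10 r12).
have PP : ProperFilter (almost_everywhere P).
  have P0 : (0 < P [set: T])%E by rewrite probability_setT lte01.
  exact: ae_properfilter_algebraOfSetsType P0.
have [w [c1 c2]] := filter_ex (filterI (kappaZ r11) (kappaZ r22)).
apply: (ler_cvg_to c2 c1); apply: nearW => n.
by rewrite ler_wpM2l ?invr_ge0//; exact: ler_lpp_slowed.
Qed.

Lemma kappa_lipschitz r1 r2 : 0 < r1 -> r1 <= r2 -> r2 <= 1 ->
  kappa r1 - kappa r2 <= r1^-1 - r2^-1.
Proof.
move=> r10 r12 r21; have r20 := lt_le_trans r10 r12.
have r11 : 0 < r1 <= 1 by rewrite r10 (le_trans r12).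
have r22 : 0 < r2 <= 1 by rewrite r20.
have c0 : 0 <= r1^-1 - r2^-1 by rewrite subr_ge0 lef_pV2 ?posrE.
set c := r1^-1 - r2^-1 in c0 *.
pose V n w := n.+1%:R^-1 * \sum_(0 <= k < n.+1) Z (k.+1, k.+1) w.
have N0 n : 0 <= n.+1%:R^-1 :> R by rewrite invr_ge0.
have mV n : measurable_fun setT (V n).
  by apply: measurable_funM => //; apply: measurable_sum.
have V0 n w : 0 <= V n w by rewrite mulr_ge0// sumr_ge0.
have mZE x : measurable_fun setT (fun w => (Z x w)%:E) by exact/measurable_EFinP.
have V1 n : (\int[P]_w (V n w)%:E <= 1%:E)%E.
  under eq_integral do rewrite EFinM -sumEFin.
  rewrite ge0_integralZl//; last 2 first.
  - exact: emeasurable_sum.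
  - by move=> w _; apply: sume_ge0 => k _; rewrite lee_fin.
  rewrite ge0_integral_sum//; last by move=> k w _; rewrite lee_fin.
  rewrite (eq_bigr (fun=> 1%:E)); last first.
    move=> k _; apply: expectation_iid_exp => //; apply: iidZ => // x.
    by rewrite mem_seq1 => /eqP->.
  by rewrite sumEFin big_const_nat subn0 iter_addr_0 -EFinM mulVf.
apply/ler_addgt0Pr => e e0.
(* chosen so that c e' <= e *)
pose e' := e / (c + 1); have c10 : 0 < c + 1 by rewrite ltr_wpDl.
have e'0 : 0 < e' by rewrite divr_gt0.
have ce : c * e' <= e.
  by rewrite mulrCA ger_pMr// ler_pdivrMr// mul1r lerDl.
have [w [[c1 c2] wV]] := frequently_below_mean mV V0 V1 (cvg_cst _)
  (filterI (kappaZ r11) (kappaZ r22)) e'0.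
have c12 : (fun n => n.+1%:R^-1 * lpp (slowed r1 (Z^~ w)) (n + 1) (n + 1) -
    n.+1%:R^-1 * lpp (slowed r2 (Z^~ w)) (n + 1) (n + 1)) @ \oo --> kappa r1 - kappa r2.
  by apply: cvgB; [exact: (cvg_shifted_ratio 0 c1)|exact: (cvg_shifted_ratio 0 c2)].
apply: (limit_le_frequently c12) => N; have [n [Nn Vn]] := wV N; exists n; split => //.
rewrite !addn1 -mulrBr; apply: (@le_trans _ _ (c * V n w)).
  rewrite /V mulrCA ler_wpM2l// lerBlDl.
  by apply: lpp_slowed_lipschitz => // x; exact: Z0.
apply: le_trans (_ : c * (1 + e') <= _); first by rewrite ler_wpM2l// ltW.
by rewrite mulrDr mulr1 lerD2l.
Qed.

Lemma kappa_ge_greedy_mean r : 0 < r <= 1 ->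
  3 / 2 + (r ^+ 2 + 2 * (1 + r)) / (2 * r * (1 + r)) <= kappa r.
Proof.
move=> r01; have /andP[r0 _] := r01; apply/ler_addgt0Pr => e e0.
have [w [cw wV]] := frequently_above_greedy_mean Z0 mZ iidZ r0 erefl (kappaZ r01) e0.
rewrite -lerBlDr; apply: (frequently_le_limit (cvg_shifted_ratio 2 cw)) => N.
by have [n [Nn Vn]] := wV N; exists n; split => //; rewrite addn3 ltW.
Qed.

Lemma slowed1 (y : nat * nat -> R) : slowed 1 y = y.
Proof. by apply/funext => x; rewrite /slowed /slow_weight invr1 if_same mul1r. Qed.

Lemma cvg_deviation_bound (C : R) : (fun n => C * harmonic n) @ \oo --> (0 : R).
Proof.
by rewrite -[X in _ --> X](mulr0 C); apply: cvgM; [exact: cvg_cst|exact: cvg_harmonic].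
Qed.

Lemma kappa1_le4 : kappa 1 <= 4.
Proof.
have one : 0 < (1 : R) <= 1 by rewrite ltr01 lexx.
have two0 : 0 < 2 :> R by [].
have half : 2^-1 + 2^-1 = 1 :> R by field.
apply/ler_addgt0Pr => e e0; have e20 : 0 < (e / 2) ^+ 2 by rewrite exprn_gt0// divr_gt0.
have mV n := measurable_funX 2 (measurable_deviation mZ 2 2 n).
have V0 n w : 0 <= deviation Z 2 2 n w ^+ 2 by exact: sqr_ge0.
have [w [cw wV]] := frequently_below_mean mV V0 (fun n =>
  deviation_sqr Z0 mZ iidZ n two0 two0 half)
  (cvg_deviation_bound _) (kappaZ one) e20.
have c2 := cvg_shifted_ratio 1 cw.
have small : (fun n => Z (1, 1)%N w * harmonic n) @ \oo --> (0 : R).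
  exact: cvg_deviation_bound.
have c3 : (fun n => n.+1%:R^-1 * lpp (slowed 1 (Z^~ w)) (n + 2) (n + 2) -
    Z (1, 1)%N w * harmonic n) @ \oo --> kappa 1.
  by rewrite -[X in _ --> X]subr0; apply: cvgB.
apply: (limit_le_frequently c3) => N; have [n [Nn Vn]] := wV N; exists n; split => //.
rewrite addn2 slowed1 /harmonic/=.
have N0 : 0 < n.+1%:R^-1 :> R by rewrite invr_gt0.
have le : lpp (Z^~ w) n.+2 n.+2 <= lpp (boundary 2 2 (Z^~ w)) n.+2 n.+2.
  by apply: lpp_boundary_mono; rewrite ?ler1n.
have dev : deviation Z 2 2 n w <= e.
  rewrite add0r in Vn; rewrite leNgt; apply/negP => ed.
  move: Vn; rewrite ltNge => /negP; apply; rewrite lerXn2r ?nnegrE//; lra.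
move: dev; rewrite /deviation lerBlDr mulrBr => dev.
rewrite [X in _ - X]mulrC (le_trans _ (le_trans dev _))//; last by lra.
by rewrite lerB// ler_wpM2l// ltW.
Qed.

(** The convexity argument at (1,1), (2,2) and (2 + h, 2 + h). *)
Lemma kappa1_ge4 : 4 <= kappa 1.
Proof.
have one : 0 < (1 : R) <= 1 by rewrite ltr01 lexx.
have two0 : 0 < 2 :> R by [].
have half : 2^-1 + 2^-1 = 1 :> R by field.
apply/ler_addgt0Pr => e e0.
(* This h is at most 1 and at most e/4, which absorbs the loss 3 h + h^2 <= 4 h. *)
pose h := e / (4 + e); have h0 : 0 < h by rewrite divr_gt0// addr_gt0.
have he : (4 + e) * h = e by rewrite mulrCA mulfV ?mulr1// gt_eqF// addr_gt0.
have h1 : h <= 1 by rewrite ler_pdivrMr ?addr_gt0// mul1r lerDr.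
have h4 : 4 * h <= e by nra.
pose a : R := 2 + h; pose b := (2 + h) / (1 + h).
have h10 : 0 < 1 + h by rewrite addr_gt0.
have a0 : 0 < a by rewrite addr_gt0.
have b0 : 0 < b by rewrite divr_gt0.
have ab : a^-1 + b^-1 = 1 by rewrite /b invf_div /a; field; rewrite gt_eqF.
have ba : b^-1 + a^-1 = 1 by rewrite addrC.
have ble : b <= a by rewrite /b ler_pdivrMr// ler_peMr ?(ltW a0)// lerDl ltW.
have abE : a + b <= 4 + h ^+ 2.
  have -> : a + b = 4 + h ^+ 2 / (1 + h) by rewrite /a /b; field; rewrite gt_eqF.
  by rewrite lerD2l ler_pdivrMr// ler_peMr ?sqr_ge0// lerDl ltW.
pose V n w := deviation Z 2 2 n w ^+ 2 + deviation Z a b n w ^+ 2 +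
  deviation Z b a n w ^+ 2.
have md x y n : measurable_fun setT (fun w => deviation Z x y n w ^+ 2).
  by apply: measurable_funX; exact: measurable_deviation.
have mV n : measurable_fun setT (V n) by do 2 apply: measurable_funD => //.
have V0 n w : 0 <= V n w by rewrite !addr_ge0 ?sqr_ge0.
pose C : R := 64 * (2 ^+ 2 + 2 ^+ 2) + 64 * (a ^+ 2 + b ^+ 2) + 64 * (b ^+ 2 + a ^+ 2).
have Vv n : (\int[P]_w (V n w)%:E <= (C * harmonic n)%:E)%E.
  have mdE x y : measurable_fun setT (fun w => (deviation Z x y n w ^+ 2)%:E).
    exact/measurable_EFinP.
  under eq_integral do rewrite /V !EFinD.
  rewrite ge0_integralD//; last 3 first.
  - by move=> w _; rewrite -EFinD lee_fin addr_ge0 ?sqr_ge0.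
  - exact: emeasurable_funD.
  - by move=> w _; rewrite lee_fin sqr_ge0.
  rewrite ge0_integralD//; last 2 first.
  - by move=> w _; rewrite lee_fin sqr_ge0.
  - by move=> w _; rewrite lee_fin sqr_ge0.
  have -> : C * harmonic n = 64 * (2 ^+ 2 + 2 ^+ 2) * harmonic n +
      64 * (a ^+ 2 + b ^+ 2) * harmonic n + 64 * (b ^+ 2 + a ^+ 2) * harmonic n.
    by rewrite /C; ring.
  by rewrite !EFinD; apply: leeD; [apply: leeD|]; exact: deviation_sqr.
(* All three deviations are below h^2 in absolute value, as the
   sum of their squares is below h^4. *)
have h20 : 0 < (h ^+ 2) ^+ 2 by rewrite !exprn_gt0.
have [w [cw wV]] := frequently_below_mean mV V0 Vv (cvg_deviation_bound _) (kappaZ one) h20.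
have z0 := Z0 (1, 1)%N w.
apply: le_trans (_ : 4 - 4 * h + e <= _); first by lra.
rewrite lerD2r; apply: (frequently_le_limit (cvg_shifted_ratio 1 cw)) => N.
have [n [Nn Vn]] := wV N; exists n; split => //.
rewrite addn2 slowed1.
have dev x : x ^+ 2 <= V n w -> x <= h ^+ 2 /\ - h ^+ 2 <= x.
  move=> xV; rewrite add0r in Vn; have := le_lt_trans xV Vn.
  have : 0 <= h ^+ 2 by rewrite sqr_ge0.
  by move: (h ^+ 2) => q q0 xq; split; nra.
have V2 x y : 0 <= deviation Z x y n w ^+ 2 by exact: sqr_ge0.
have [p22 pab pba] : [/\ deviation Z 2 2 n w ^+ 2 <= V n w,
    deviation Z a b n w ^+ 2 <= V n w & deviation Z b a n w ^+ 2 <= V n w].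
  by have := V2 2 2; have := V2 a b; have := V2 b a; rewrite /V; split; lra.
have [_ d22] := dev _ p22; have [dab _] := dev _ pab; have [dba _] := dev _ pba.
have N0 : 0 < n.+1%:R^-1 :> R by rewrite invr_gt0.
have conv1 := lpp_boundary_convex 2 2 (Z^~ w) n.+2 n.+2 (ltW h0).
have aE : 2 + h * (2 - 1) = a by rewrite /a; ring.
rewrite aE in conv1.
have corner := lpp_boundary_corner n.+2 n.+2 (ltW b0) ble (fun x => Z0 x w).
have {}d22 : 4 - h ^+ 2 <= n.+1%:R^-1 * (lpp (boundary 2 2 (Z^~ w)) n.+2 n.+2 - Z (1,
  1)%N w).
  by move: d22; rewrite /deviation; move: (_^-1 * _) => X; lra.
have {}dab : n.+1%:R^-1 * (lpp (boundary a b (Z^~ w)) n.+2 n.+2 - Z (1,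
  1)%N w) <= a + b + h ^+ 2.
  by move: dab; rewrite /deviation; move: (_^-1 * _) => X; lra.
have {}dba : n.+1%:R^-1 * (lpp (boundary b a (Z^~ w)) n.+2 n.+2 - Z (1,
  1)%N w) <= a + b + h ^+ 2.
  by move: dba; rewrite /deviation; move: (_^-1 * _) => X; lra.
move: conv1 corner d22 dab dba.
set G22 := lpp (boundary 2 2 _) _ _; set Gaa := lpp (boundary a a _) _ _.
set Gab := lpp (boundary a b _) _ _; set Gba := lpp (boundary b a _) _ _.
set G := lpp _ _ _; set N' := n.+1%:R^-1; set z := Z _ w => conv1 corner d22 dab dba.
have daa : N' * (Gaa - z) <= a + b + h ^+ 2.
  apply: le_trans (_ : N' * (Num.max Gab Gba - z) <= _).
    by rewrite ler_wpM2l ?(ltW N0)// lerB.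
  by rewrite maxEle; case: ifP.
have key : h * (N' * (G - z)) >= (1 + h) * (4 - h ^+ 2) - (a + b + h ^+ 2).
  apply: (@le_trans _ _ ((1 + h) * (N' * (G22 - z)) - N' * (Gaa - z))).
    by rewrite lerB// ler_wpM2l// ltW.
  rewrite -subr_ge0 [X in 0 <= X](_ : _ = N' * (h * G + Gaa - (1 + h) * G22)); last by ring.
  by rewrite mulr_ge0 ?(ltW N0)// subr_ge0.
have : h * (4 - 4 * h) <= h * (N' * (G - z)).
  apply: le_trans _ key; have := mulr_ge0 (ltW h0) (ltW h0); nra.
rewrite ler_pM2l// => /le_trans; apply; rewrite ler_wpM2l ?(ltW N0)//.
by rewrite gerBl.
Qed.

End TimeConstant.

(** * From the given variables to nonnegative ones, and the theorem *)

(** Positive parts do not change the exponential law; they make every path weight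
    nonnegative at every sample point. *)
Lemma exp1_max0 (R : realType) (A : set R) : measurable A ->
  exp1 ((fun x : R => Num.max 0 x) @^-1` A) = exp1 A.
Proof.
move=> mA; pose m0 (x : measurableTypeR R) : measurableTypeR R := Num.max 0 x.
have mm0 : measurable_fun setT m0 by exact: measurable_maxr.
have mB : measurable (m0 @^-1` A) by rewrite -[_ @^-1` _]setTI; exact: mm0.
have key (B : set R) : measurable B -> exp1 B = exp1 (B `&` `]0, +oo[%classic).
  move=> mB'.
  rewrite [in LHS](_ : B = (B `&` `]0, +oo[%classic) `|` (B `&` `]-oo, 0]%classic)).
    rewrite measureU; [|exact: measurableI|exact: measurableI|]; last first.
      apply/seteqP; split => // x [] [_ x0] [_ x1]; move: x0 x1 => /=.
      by rewrite !in_itv/= ?andbT => x0; rewrite leNgt x0.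
    rewrite [X in (_ + X)%E](_ : _ = 0%E) ?adde0//.
    apply/eqP; rewrite eq_le measure_ge0 andbT -exp1_le0.
    by apply: le_measure; rewrite ?inE//; exact: measurableI.
  rewrite -setIUr (_ : _ `|` _ = setT) ?setIT//.
  by apply/seteqP; split => // x _ /=; rewrite !in_itv/= andbT; case: ltP => _;
    [left|right].
rewrite [LHS]key// [RHS]key//; congr (exp1 _).
apply/seteqP; split => x [] /=; rewrite in_itv/= andbT /m0 => + x0;
  by rewrite (max_idPr (ltW x0)).
Qed.

Lemma iid_exp_positive_part (R : realType) (d : measure_display) (T : measurableType d)
    (P : probability T R) (Y : nat * nat -> {RV P >-> R}) (s : seq (nat * nat)) :
  iid_exponential_mean1 sites Y -> uniq s -> (forall x, x \in s -> sites x) ->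
  iid_exp P s (fun x w => Num.max 0 (Y x w)).
Proof.
move=> [indY lawY] us ss.
have mmax (x : nat * nat) : measurable_fun setT (fun w => Num.max 0 (Y x w)).
  by apply: measurable_maxr.
split => // B mB.
have mB' i : measurable ((fun x : R => Num.max 0 x) @^-1` B i).
  have m0 : measurable_fun setT (fun x : R => Num.max 0 x) by exact: measurable_maxr.
  by rewrite -[_ @^-1` _]setTI; exact: m0.
have := indY s (fun i => (fun x : R => Num.max 0 x) @^-1` B i) us ss mB'.
move=> ->; rewrite !big_seq; apply: eq_bigr => i is'.
apply: (etrans (lawY i (ss i is') _ (mB' i))).
by apply: (etrans (esym (exp1E _))); exact: exp1_max0.
Qed.

Theorem theorem2p1 (R : realType) (d : measure_display) (T : measurableType d)
    (P : probability T R) (Y : nat * nat -> {RV P >-> R})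
    (hY : iid_exponential_mean1 sites Y)
    (kappa : R -> R)
    (hkappa : forall r : R, 0 < r <= 1 -> is_as_time_constant Y r (kappa r)) :
  [/\ {within `]0, 1], continuous kappa},
      (forall r1 r2 : R, 0 < r1 -> r1 <= r2 -> r2 <= 1 -> kappa r2 <= kappa r1),
      (forall r1 r2 : R, 0 < r1 -> r1 < r2 -> r2 <= 1 ->
         0 <= kappa r1 - kappa r2 <= r1^-1 - r2^-1) &
      (forall r : R, 0 < r <= 1 ->
         Num.max 4 (3 / 2 + (r ^+ 2 + 2 * (1 + r)) / (2 * r * (1 + r)))
           <= kappa r <= 3 + r^-1)].
Proof.
pose Z (x : nat * nat) w := Num.max 0 (Y x w).
have Z0 x w : 0 <= Z x w by rewrite le_max lexx.
have mZ x : measurable_fun setT (Z x) by exact: measurable_maxr.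
have iidZ s : uniq s -> (forall x, x \in s -> sites x) -> iid_exp P s Z.
  exact: iid_exp_positive_part.
have aeY : {ae P, forall w, forall i j, Y (i.+1, j.+1) w = Z (i.+1, j.+1) w}.
  apply: ae_foralln => i; apply: ae_foralln => j.
  have sij : sites (i.+1, j.+1) by [].
  exists (Y (i.+1, j.+1) @^-1` `]-oo, 0]%classic); split.
  - by rewrite -[_ @^-1` _]setTI; exact: measurable_funP.
  - have [_ lawY] := hY; apply: (etrans (lawY _ sij _ (measurable_itv `]-oo, 0]))).
    by apply: (etrans (esym (exp1E _))); exact: exp1_le0.
  - move=> w /= YZ; rewrite in_itv/= leNgt; apply/negP => Ypos; apply: YZ.
    by rewrite /Z (max_idPr (ltW Ypos)).
have kappaZ r : 0 < r <= 1 ->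
    {ae P, forall w, (fun n => n%:R^-1 * lpp (slowed r (Z^~ w)) n n) @ \oo --> kappa r}.
  move=> r01; have /andP[r0 _] := r01.
  apply: filterS2 (hkappa r r01) aeY => w cw YZ.
  rewrite [X in X @ \oo --> _](_ : _ =
    (fun n => n%:R^-1 * passage_time r (fun x => Y x w) n))//.
  apply/funext => -[|n]; first by rewrite invr0 !mul0r.
  have YZ' x : sites x -> Y x w = Z x w by case: x => [[|i] [|j]] [].
  rewrite passage_timeE//; last by move=> x /YZ'->.
  by congr (_ * _); apply: eq_lpp => x /YZ' e; rewrite /slowed e.
have mono := kappa_nonincreasing Z0 kappaZ.
have lip := kappa_lipschitz Z0 mZ iidZ kappaZ.
split => //.
- apply/subspace_continuousP => x; rewrite /= in_itv/= => /andP[x0 x1].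
  apply/cvgrPdist_lt => e e0.
  have invx : (fun y : R => y^-1) @ x --> x^-1 by apply: inv_continuous; rewrite gt_eqF.
  rewrite near_withinE; near=> y; rewrite /= in_itv/= => /andP[y0 y1].
  have : `|x^-1 - y^-1| < e by near: y; move/cvgrPdist_lt : invx; exact.
  apply: le_lt_trans; have [xy|/ltW yx] := leP x y.
    rewrite !ger0_norm ?subr_ge0 ?mono//; first exact: lip.
    by rewrite lef_pV2 ?posrE.
  rewrite distrC [leRHS]distrC !ger0_norm ?subr_ge0 ?mono//; first exact: lip.
  by rewrite lef_pV2 ?posrE.
- move=> r1 r2 r10 /ltW r12 r21; rewrite subr_ge0 mono//=; exact: lip.
- move=> r r01; have /andP[r0 r1] := r01.
  rewrite ge_max (le_trans (kappa1_ge4 Z0 mZ iidZ kappaZ)) ?mono//=.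
  rewrite (kappa_ge_greedy_mean Z0 mZ iidZ kappaZ)//=.
  have := lip r 1 r0 r1 (lexx _); have := kappa1_le4 Z0 mZ iidZ kappaZ.
  rewrite invr1; lra.
Unshelve. all: by end_near. Qed.
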